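(* Let $\mu$ be a partition of the integer $k$ with $\ell(\mu)$ parts, and let $(S_1,S_2)$ be a fixed couple of pair-partitions of $[2k]$ of type $\mu$. Let $\mathbf{p}=(p_1,\dots,p_m)$ and $\mathbf{q}=(q_1,\dots,q_m)$ be sequences of positive integers with $q_1\ge\cdots\ge q_m$, and let $\mathbf{p}\times\mathbf{q}$ be the partition consisting of $q_1$ repeated $p_1$ times, then $q_2$ repeated $p_2$ times, etc. Then $$\Sigma^{(2)}_\mu(\mathbf{p}\times\mathbf{q})=\frac{(-1)^k}{2^{\ell(\mu)}}\sum_{S_0}\Bigg[\sum_{\varphi:\mathcal{L}(S_0,S_2)\to\mathbb{N}^\star}\ \prod_{l\in\mathcal{L}(S_0,S_2)}p_{\varphi(l)}\cdot\prod_{l'\in\mathcal{L}(S_0,S_1)}\big(-2q_{\psi(l')}\big)\Bigg],$$ where $S_0$ runs over pair-partitions of $[2k]$, $p_i=q_i=0$ for $i>m$, and $\psi(l')=\max_l\varphi(l)$ with $l$ running over the loops of $\mathcal{L}(S_0,S_2)$ having at least one element in common with $l'$.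
   Context: A pair-partition of $[2k]$ is a set of pairwise disjoint two-element subsets with union $[2k]$, identified with the fixed-point-free involution sending each element to its partner. For pair-partitions $A,B$ of $[2k]$, $\mathcal{L}(A,B)$ is the bipartite graph with a black vertex for each pair of $A$, a white vertex for each pair of $B$, and for each $i\in[2k]$ an edge labeled $i$ joining the pair of $A$ containing $i$ to the pair of $B$ containing $i$; it is a disjoint union of loops of lengths $2\ell_1\ge2\ell_2\ge\cdots$, each loop viewed as the set of labels of its edges; $(\ell_1,\ell_2,\dots)$ is the type of $(A,B)$. Zonal characters: write the zonal polynomial (Jack polynomial $J^{(2)}_\lambda$, Macdonald normalization) as $Z_\lambda=\sum_{|\rho|=|\lambda|}\theta^{(2)}_\rho(\lambda)p_\rho$. For $|\lambda|\ge|\mu|$, $\Sigma^{(2)}_\mu(\lambda)=\binom{|\lambda|-|\mu|+m_1(\mu)}{m_1(\mu)}z_\mu\theta^{(2)}_{\mu\cup1^{|\lambda|-|\mu|}}(\lambda)$, and $0$ if $|\lambda|<|\mu|$, where $m_i(\mu)$ is the multiplicity of $i$ in $\mu$ and $z_\mu=\prod_i i^{m_i(\mu)}m_i(\mu)!$. *)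

(* Defs.v *)
From HB Require Import structures.
From mathcomp Require Import all_boot all_order all_algebra.
From mathcomp Require Import mpoly.
Set Implicit Arguments. Unset Strict Implicit. Unset Printing Implicit Defensive.
Import Order.TTheory GRing.Theory Num.Theory.

Definition is_partition (n : nat) (r : seq nat) : bool :=
  [&& sorted geq r, all (fun x => 0 < x) r & sumn r == n].

Definition ptn_of (n : nat) (t : {ffun 'I_n -> 'I_n.+1}) : seq nat :=
  [seq x <- [seq (t i : nat) | i <- enum 'I_n] | x != 0].

Definition partitions (n : nat) : seq (seq nat) :=
  [seq r <- undup [seq ptn_of t | t <- enum {ffun 'I_n -> 'I_n.+1}]
     | is_partition n r].

Definition dominated (mu la : seq nat) : bool :=
  [forall j : 'I_(size mu + size la).+1,
     \sum_(i < j) nth 0 mu i <= \sum_(i < j) nth 0 la i]%N.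

Definition mult (i : nat) (mu : seq nat) : nat := count_mem i mu.
Definition zee (mu : seq nat) : nat :=
  \prod_(i <- undup mu) (i ^ mult i mu * (mult i mu)`!)%N.

Local Open Scope ring_scope.

Definition psum (n i : nat) : {mpoly rat[n]} := \sum_(j < n) 'X_j ^+ i.
Definition pprod (n : nat) (r : seq nat) : {mpoly rat[n]} :=
  \prod_(i <- r) psum n i.

Definition pexp (n : nat) (c : seq nat -> rat) : {mpoly rat[n]} :=
  \sum_(r <- partitions n) c r *: pprod n r.

Definition mshape (n : nat) (e : 'X_{1..n}) : seq nat :=
  [seq x <- sort geq [seq e i | i <- enum 'I_n] | (0 < x)%N].

(* the alpha = 2 scalar product <p_rho, p_sigma> = delta z_rho 2^{l(rho)} *)
Definition zdot (n : nat) (c d : seq nat -> rat) : rat :=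
  \sum_(r <- partitions n) c r * d r * (zee r)%:R * 2 ^+ size r.

(* [is_zonal_pexp la c] : with n = |la|, the coefficients c(rho) (rho |- n)
   are those of the power-sum expansion of the zonal polynomial
   Z_la = J^{(2)}_la (Macdonald normalization), i.e. Z_la = sum c(rho) p_rho.
   The Jack polynomial is characterized (Macdonald, Ch. VI.10) by
   (1) monomial triangularity: only m_nu with nu <= la (dominance) occur,
   (2) orthogonality w.r.t. <.,.>_2 to every m_nu with nu < la,
   (3) normalization of J: the coefficient of m_{1^n} (= of x_1...x_n) is n!.
   Symmetric functions of degree n are faithfully represented in n variables. *)
Definition is_zonal_pexp (la : seq nat) (c : seq nat -> rat) : Prop :=
  let n := sumn la in
  [/\ forall e : 'X_{1..n}, (pexp n c)@_e != 0 -> dominated (mshape e) la,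
      forall d : seq nat -> rat,
        (forall e : 'X_{1..n}, (pexp n d)@_e != 0 ->
            dominated (mshape e) la && (mshape e != la)) ->
        zdot n c d = 0
    & (pexp n c)@_[multinom (1%N) | i < n] = (n`!)%:R].

(* Sigma^{(2)}_mu(la), given the zonal coefficients theta(.) = theta_.(la) *)
Definition Sigma2 (mu la : seq nat) (theta : seq nat -> rat) : rat :=
  let n := sumn la in let k := sumn mu in
  if (k <= n)%N then
    ('C(n - k + mult 1 mu, mult 1 mu))%:R * (zee mu)%:R *
      theta (mu ++ nseq (n - k) 1%N)
  else 0.

Definition ptimes (p q : seq nat) : seq nat :=
  flatten [seq nseq pr.1 pr.2 | pr <- zip p q].

Definition pairpart (N : nat) (A : {ffun 'I_N -> 'I_N}) : bool :=
  [forall i, (A (A i) == i) && (A i != i)].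

(* two labels lie on the same loop of L(A,B) iff they are connected by
   steps i -> A i (same black vertex) and i -> B i (same white vertex) *)
Definition loops (N : nat) (A B : {ffun 'I_N -> 'I_N}) : {set {set 'I_N}} :=
  [set [set j | connect (fun x y => (y == A x) || (y == B x)) i j] | i : 'I_N].

Definition ptype (N : nat) (A B : {ffun 'I_N -> 'I_N}) : seq nat :=
  sort geq (map (fun l : {set 'I_N} => (#|l| %/ 2)%N) (enum (mem (loops A B)))).

(* phi : loops of L(A,B) -> {1,..,m} encoded as a finfun on sets with values
   in 'I_m.+1, equal to 0 exactly off the loops *)
Definition loopfun (N m : nat) (A B : {ffun 'I_N -> 'I_N})
    (phi : {ffun {set 'I_N} -> 'I_m.+1}) : bool :=
  [forall l, (l \in loops A B) == (phi l != ord0)].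

(* 1-based indexing with value 0 beyond the end *)
Definition at1 (s : seq nat) (i : nat) : nat := if i is i'.+1 then nth 0 s i' else 0.

(* Main.v *)
Require Import Defs.
From HB Require Import structures.
From mathcomp Require Import all_boot all_order all_algebra.
From mathcomp Require Import fingroup perm.
From mathcomp Require Import zify ring.
From mathcomp Require Import mpoly.
Set Implicit Arguments. Unset Strict Implicit. Unset Printing Implicit Defensive.
Import Order.TTheory GRing.Theory Num.Theory.

(** Let T be the set of boxes of the diagram of 2 lambda, paired into the dominoes S. The signed
count Theta(r) of pairs (B, A) of type r, where the pairing B preserves columns, A preserves rows
and the sign is given by the number of loops of (S, B), satisfies the three conditions that
characterize the power-sum coefficients of the zonal polynomial. For triangularity, conjugating B
by a transposition inside one half of a column reverses its sign, so that only colourings without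
repetition in the columns survive. For orthogonality to d, the coefficients of d in dominating
monomials vanish, which says that certain sums of d over the pairings compatible with a colouring
vanish when the colouring is compatible with the other pairing; exchanging colours one label at a
time removes this last restriction.

Expanding the right-hand side of the formula into maps from labels to boxes, conjugating S_0 by a
transposition cancels the non-injective maps. An injective map transports (S_1, S_2) to a pair
(B, A) of type mu together with parts equal to 1, and the number of equivariant injections of
(S_1, S_2) into such a pair is 2^l(mu) z_mu times the binomial coefficient of Sigma. *)

(** * Loops of a pair of pairings *)

(** In the orthogonality step the fixed pairing B moves boxes between rows, whereas the coefficient
    of d in a monomial is a sum over colourings that the fixed pairing respects. The gap is closed
    by an exchange identity: recolouring one label from b to a, summed over that label, equals
    recolouring one label from a to b, because a pairing that respects the new colouring matches the
    recoloured label with a label of its new colour, and recolouring that partner instead is equally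
    compatible. Applied at a badly coloured pair, the identity expresses a multiple of the wanted
    sum through colourings with either more unequal classes or fewer bad pairs, and domination over
    lambda survives both changes, so an induction closes.

    The signs rest on the two halves of each box. All pairings whose loops carry a sign switch
    halves, so their loops are the cycles of a composite of two pairings on one half, and the parity
    of the number of loops is that of a permutation. *)

Definition pairing (T : finType) (A : T -> T) : bool :=
  [forall x, (A (A x) == x) && (A x != x)].

Lemma pairingP (T : finType) (A : T -> T) :
  reflect ((forall x, A (A x) = x) /\ (forall x, A x != x)) (pairing A).
Proof.
apply: (iffP forallP) => [H | [H1 H2] x]; last by rewrite H1 H2 eqxx.
by split=> x; case/andP: (H x) => // /eqP.
Qed.

Definition loopof (T : finType) (A B : T -> T) (x : T) : {set T} :=
  [set y | connect (fun x y => (y == A x) || (y == B x)) x y].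

Definition loopset (T : finType) (A B : T -> T) : {set {set T}} :=
  [set loopof A B x | x : T].

Definition looptype (T : finType) (A B : T -> T) : seq nat :=
  sort geq (map (fun l : {set T} => (#|l| %/ 2)%N) (enum (mem (loopset A B)))).

Definition halfsize (T : finType) (A B : T -> T) (x : T) : nat :=
  (#|loopof A B x| %/ 2)%N.

Section Loops.

Variables (T : finType) (A B : T -> T).
Hypotheses (pA : pairing A) (pB : pairing B).

Let AK x : A (A x) = x. Proof. by case/pairingP: pA => /(_ x). Qed.
Let BK x : B (B x) = x. Proof. by case/pairingP: pB => /(_ x). Qed.
Let Ax x : A x != x. Proof. by case/pairingP: pA => _ /(_ x). Qed.
Let Bx x : B x != x. Proof. by case/pairingP: pB => _ /(_ x). Qed.

Notation e := (fun x y => (y == A x) || (y == B x)).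
Let f x := A (B x).

Lemma loop_sym x y : connect e x y = connect e y x.
Proof.
apply: sym_connect_sym x y => x y /=.
by congr (_ || _); apply/eqP/eqP=> ->.
Qed.

Lemma mem_loopof x : x \in loopof A B x.
Proof. by rewrite inE connect0. Qed.

Lemma loopof_eq x y : (loopof A B x == loopof A B y) = (y \in loopof A B x).
Proof.
apply/eqP/idP => [-> | ]; first exact: mem_loopof.
rewrite inE => xy; apply/setP=> z; rewrite !inE.
by apply/idP/idP; apply: connect_trans => //; rewrite loop_sym.
Qed.

Lemma loopofA x : loopof A B (A x) = loopof A B x.
Proof.
by apply/esym/eqP; rewrite loopof_eq inE connect1 //= eqxx.
Qed.

Lemma loopofB x : loopof A B (B x) = loopof A B x.
Proof.
by apply/esym/eqP; rewrite loopof_eq inE connect1 //= eqxx orbT.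
Qed.

Lemma loopof_const (V : Type) (h : T -> V) :
  (forall x, h (A x) = h x) -> (forall x, h (B x) = h x) ->
  forall x y, y \in loopof A B x -> h y = h x.
Proof.
move=> hA hB x y; rewrite inE => /connectP[s ps ->].
elim: s x ps => //= z s IH x /andP[/orP[]/eqP-> /IH->]; by rewrite ?hA ?hB.
Qed.

Lemma loopof_closed (P : pred T) : (forall x, P x -> P (A x)) ->
  (forall x, P x -> P (B x)) -> forall x, P x -> {in loopof A B x, forall y, P y}.
Proof.
move=> PA PB x Px y; rewrite inE => /connectP[s ps ->].
elim: s x Px ps => //= z s IH x Px /andP[/orP[]/eqP-> ps]; apply: IH ps; auto.
Qed.

Let finj : injective f.
Proof. by move=> x y /(congr1 (B \o A)); rewrite /f /= !AK !BK. Qed.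


(** Conjugation by the involution [B] inverts [f], so [B] carries an [f]-cycle to one run
    backwards. *)
Lemma loop_fB i x : iter i f (B (iter i f x)) = B x.
Proof.
elim: i x => //= i IH x.
by rewrite -[f (iter i f x)]/(iter i.+1 f x) iterSr IH /f BK AK.
Qed.

(** On such a cycle the inverse of [f] is its [m]-th power; writing [i * m] for [- i] avoids naming
    an inverse. *)
Lemma loop_B_iter m i x : iter m.+1 f x = x ->
  B (iter i f x) = iter (i * m) f (B x).
Proof.
move=> fx; have fxi : iter (i * m.+1) f x = x by elim: i => // i IH; rewrite mulSn iterD IH.
by rewrite -[in RHS]fxi mulnS addnC iterD loop_fB.
Qed.

Let iter_ordS x : iter (fingraph.order f x).-1.+1 f x = x.
Proof. by rewrite prednK ?fingraph.order_gt0 // fingraph.iter_order. Qed.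

(** Cancelling one [f] at each end of an equality lowers [i] by two, and for [i = 0] or [i = 1] one
    of the pairings would have a fixed point. *)
Lemma loop_iterB_neq i x : iter i f x != B x.
Proof.
elim/ltn_ind: i x => -[|[|i]] IH x; first by rewrite eq_sym.
  exact: Ax.
apply/negP=> /eqP H; have /negP[] := IH i (leqnSn _) (f x).
apply/eqP/finj; rewrite -iterS -iterSr H.
by rewrite /f BK AK.
Qed.

Lemma loop_disj x : ~~ fconnect f x (B x).
Proof.
by apply/negP=> /iter_findex H; have /negP[] := loop_iterB_neq (findex f x (B x)) x; rewrite H.
Qed.

(** A loop splits into the two [f]-cycles through [x] and [B x]. They are disjoint and of equal
    length, so the half-size of a loop is the order of its labels under [f]. *)
Lemma in_loopof x y : (y \in loopof A B x) = fconnect f x y || fconnect f (B x) y.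
Proof.
have fl z t : fconnect f z t -> t \in loopof A B z.
  move=> /iter_findex<-; elim: findex => [|i IH] /=; first exact: mem_loopof.
  by rewrite /f -loopof_eq loopofA loopofB loopof_eq.
apply/idP/orP; last by case=> /fl //; rewrite loopofB.
move=> yx; apply/orP.
have PB z : fconnect f x z || fconnect f (B x) z -> fconnect f x (B z) || fconnect f (B x) (B z).
  case/orP=> /iter_findex <-; rewrite (loop_B_iter _ (iter_ordS _)) ?BK.
    by rewrite fconnect_iter orbT.
  by rewrite fconnect_iter.
apply: (@loopof_closed (fun y => fconnect f x y || fconnect f (B x) y)) yx => //=; last by rewrite connect0.
move=> z /PB; have -> : A z = f (B z) by rewrite /f BK.
by rewrite -!same_fconnect1_r.
Qed.

Lemma loop_orderB x : fingraph.order f (B x) = fingraph.order f x.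
Proof.
have sub y : fingraph.order f (B y) <= fingraph.order f y.
  rewrite /fingraph.order -(card_image (can_inj BK) (fconnect f y)).
  apply/subset_leq_card/subsetP => z.
  rewrite -topredE /= => /iter_findex <-.
  apply/imageP; exists (iter (findex f (B y) z * (fingraph.order f (B y)).-1) f y).
    exact: fconnect_iter.
  by apply: (can_inj BK); rewrite BK (loop_B_iter _ (iter_ordS _)) BK.
by apply/eqP; rewrite eqn_leq sub /= -{1}(BK x) sub.
Qed.

Lemma card_loopof x : #|loopof A B x| = (fingraph.order f x).*2.
Proof.
rewrite -addnn -{2}loop_orderB /order -cardUI.
rewrite [X in (_ + X)%N](_ : _ = 0) ?addn0.
  by apply: eq_card => y; rewrite in_loopof !inE.
apply: eq_card0 => y; rewrite !inE; apply/negP=> /andP[xy Bxy].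
have /negP[] := loop_disj x; apply: (connect_trans xy).
by rewrite fconnect_sym.
Qed.

Lemma halfsizeE x : halfsize A B x = fingraph.order f x.
Proof. by rewrite /halfsize card_loopof -muln2 mulnK. Qed.

Lemma halfsize_gt0 x : 0 < halfsize A B x.
Proof. by rewrite halfsizeE fingraph.order_gt0. Qed.

Lemma card_loopofE x : #|loopof A B x| = (halfsize A B x).*2.
Proof. by rewrite halfsizeE card_loopof. Qed.

Lemma halfsize1 x : (halfsize A B x == 1%N) = (A x == B x).
Proof.
rewrite halfsizeE; apply/eqP/eqP=> [o1|AB]; last first.
  apply/eqP; rewrite eqn_leq fingraph.order_gt0 andbT -[1%N](card1 x).
  apply/subset_leq_card/subsetP=> y; rewrite -topredE /= => /iter_findex <-.
  rewrite inE; apply/eqP; elim: findex => //= i ->.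
  by rewrite /f -AB AK.
have := iter_order finj (B x); rewrite loop_orderB o1 /= /f BK => ->.
by [].
Qed.

End Loops.

(** A canonical label in each loop, which lets sums and products over loops range over the fixed
    points of [looprep]. The default [x] is never reached, since a loop contains its own label. *)
Definition looprep (T : finType) (A B : T -> T) (x : T) : T :=
  odflt x [pick y in loopof A B x].

Definition loopreps (T : finType) (A B : T -> T) : seq T :=
  [seq x <- enum T | looprep A B x == x].

Section LoopReps.

Variables (T : finType) (A B : T -> T).
Hypotheses (pA : pairing A) (pB : pairing B).

Lemma looprep_in x : looprep A B x \in loopof A B x.
Proof. by rewrite /looprep; case: pickP => // _; rewrite mem_loopof. Qed.

Lemma looprep_eq x y : (looprep A B x == looprep A B y) = (loopof A B x == loopof A B y).
Proof.
apply/eqP/eqP=> [E|E].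
  have := looprep_in x; rewrite -loopof_eq // => /eqP ->; rewrite E.
  by apply/esym/eqP; rewrite loopof_eq // looprep_in.
rewrite /looprep E; case: pickP => // /(_ y).
by rewrite mem_loopof.
Qed.

Lemma looprep_id x : looprep A B (looprep A B x) = looprep A B x.
Proof. by apply/eqP; rewrite looprep_eq eq_sym loopof_eq // looprep_in. Qed.

Lemma loopof_rep x : loopof A B (looprep A B x) = loopof A B x.
Proof. by apply/esym/eqP; rewrite loopof_eq // looprep_in. Qed.

Lemma mem_loopreps x : (x \in loopreps A B) = (looprep A B x == x).
Proof. by rewrite mem_filter mem_enum andbT. Qed.

Lemma loopreps_uniq : uniq (loopreps A B).
Proof. by rewrite filter_uniq ?enum_uniq. Qed.

Lemma loopset_rep : loopset A B = [set loopof A B x | x in [pred x | looprep A B x == x]].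
Proof.
apply/setP=> l; apply/imsetP/imsetP=> -[x _ ->]; last by exists x.
by exists (looprep A B x); rewrite ?inE ?looprep_id ?loopof_rep.
Qed.

Lemma loopof_rep_inj : {in [pred x | looprep A B x == x] &, injective (loopof A B)}.
Proof.
by move=> x y; rewrite !inE => /eqP <- /eqP <- /eqP; rewrite !loopof_rep -looprep_eq => /eqP.
Qed.

Lemma big_loopset (R : Type) (idx : R) (op : Monoid.com_law idx) (F : {set T} -> R) :
  \big[op/idx]_(l in loopset A B) F l =
  \big[op/idx]_(x | looprep A B x == x) F (loopof A B x).
Proof. by rewrite loopset_rep big_imset //=; exact: loopof_rep_inj. Qed.

Lemma card_loopset : #|loopset A B| = size (loopreps A B).
Proof.
rewrite loopset_rep card_in_imset; last exact: loopof_rep_inj.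
rewrite -(card_uniqP loopreps_uniq); apply: eq_card => x.
by rewrite mem_loopreps.
Qed.

Lemma perm_looptype :
  perm_eq (looptype A B) [seq halfsize A B x | x <- loopreps A B].
Proof.
rewrite perm_sort /halfsize (map_comp (fun l : {set T} => (#|l| %/ 2)%N) (loopof A B)).
apply: perm_map; apply: uniq_perm; first exact: enum_uniq.
  rewrite map_inj_in_uniq ?loopreps_uniq // => x y; rewrite !mem_loopreps => rx ry.
  by apply: loopof_rep_inj.
move=> l; rewrite mem_enum loopset_rep; apply/imsetP/mapP=> -[x rx ->]; exists x => //.
  by rewrite mem_loopreps.
by rewrite mem_loopreps in rx.
Qed.

Lemma size_looptype : size (looptype A B) = #|loopset A B|.
Proof. by rewrite (perm_size perm_looptype) size_map card_loopset. Qed.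

Lemma sum_loopreps (F : T -> nat) :
  \sum_x F x = \sum_(x <- loopreps A B) \sum_(y in loopof A B x) F y.
Proof.
rewrite big_filter big_enum_cond /=.
rewrite (partition_big (looprep A B) (fun x => looprep A B x == x)) /=; last first.
  by move=> x _; rewrite looprep_id.
apply: eq_bigr => x /eqP rx; apply: eq_bigl => y.
by rewrite -{1}rx looprep_eq -loopof_eq // eq_sym.
Qed.

Lemma halfsize_in x y : y \in loopof A B x -> halfsize A B y = halfsize A B x.
Proof. by rewrite -loopof_eq // /halfsize => /eqP->. Qed.

Lemma card_halfsize s :
  #|[set x | halfsize A B x == s]| = (s.*2 * count_mem s (looptype A B))%N.
Proof.
rewrite (seq.permP perm_looptype) count_map cardsE -sum1_card [in LHS]big_mkcond sum_loopreps.
rewrite -sum1_count [in RHS]big_mkcond big_distrr /=; apply: eq_bigr => x _.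
transitivity (\sum_(y in loopof A B x) (if halfsize A B x == s then 1 else 0))%N.
  by apply: eq_bigr => y /halfsize_in E; rewrite unfold_in /= E.
rewrite sum_nat_const card_loopofE //.
by case: eqP => [->|]; rewrite ?muln0.
Qed.

Lemma looptype_sorted : sorted geq (looptype A B).
Proof. by apply: sort_sorted => x y; apply: leq_total. Qed.

Lemma looptype_pos : all (fun s => 0 < s)%N (looptype A B).
Proof.
rewrite (perm_all _ perm_looptype) all_map; apply/allP=> x _.
exact: halfsize_gt0.
Qed.

Lemma sumn_looptype : ((sumn (looptype A B)).*2 = #|T|)%N.
Proof.
rewrite (perm_sumn perm_looptype) -sum1_card sum_loopreps.
elim: (loopreps A B) => [|x s IH] /=; first by rewrite big_nil.
by rewrite big_cons doubleD IH sum1_card card_loopofE.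
Qed.

Lemma looptype_partition n : #|T| = n.*2 -> is_partition n (looptype A B).
Proof.
move=> cT; rewrite /is_partition looptype_sorted looptype_pos /=.
by have := sumn_looptype; rewrite cT => /double_inj ->.
Qed.

End LoopReps.

(** A part i of the type is witnessed by 2i labels, so types can be compared by counting labels,
    without matching loops. Positivity of the parts matters here: a part 0 would be invisible to the
    count. *)
Lemma perm_looptypeP (T : finType) (A B : T -> T) (s : seq nat) :
  pairing A -> pairing B -> all (fun i => 0 < i)%N s ->
  (forall i, #|[set x | halfsize A B x == i]| = (i.*2 * count_mem i s)%N) <->
  perm_eq (looptype A B) s.
Proof.
move=> pA pB s0; split=> [H | /seq.permP H i]; last by rewrite card_halfsize // H.
apply/allP => i; rewrite mem_cat => i0 /=; apply/eqP.
have {}i0 : (0 < i)%N.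
  by case/orP: i0; [have /allP := looptype_pos pA pB | move/allP: s0]; apply.
by apply/eqP; have := H i; rewrite card_halfsize // => /eqP; rewrite eqn_pmul2l ?double_gt0.
Qed.

Lemma sorted_perm_eq (s t : seq nat) :
  sorted geq s -> sorted geq t -> perm_eq s t -> s = t.
Proof.
apply: sorted_eq => [y x z /= xy yz|x y /andP[/= xy yx]]; first exact: leq_trans yz xy.
by apply/eqP; rewrite eqn_leq xy yx.
Qed.

(** * Equivariant injections *)

Definition equivariant (T0 T1 : finType) (A0 B0 : T0 -> T0) (A1 B1 : T1 -> T1)
    (g : T0 -> T1) : bool :=
  [forall x, (g (A0 x) == A1 (g x)) && (g (B0 x) == B1 (g x))].

Section Equivariant.

Variables (T0 T1 : finType) (A0 B0 : T0 -> T0) (A1 B1 : T1 -> T1).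
Hypotheses (pA0 : pairing A0) (pB0 : pairing B0).
Hypotheses (pA1 : pairing A1) (pB1 : pairing B1).

Lemma equivariantP (g : T0 -> T1) :
  reflect ((forall x, g (A0 x) = A1 (g x)) /\ (forall x, g (B0 x) = B1 (g x)))
          (equivariant A0 B0 A1 B1 g).
Proof.
apply: (iffP forallP) => [H | [H1 H2] x]; last by rewrite H1 H2 !eqxx.
by split=> x; case/andP: (H x) => /eqP ? /eqP ?.
Qed.

Lemma equivariant_ext g h x : equivariant A0 B0 A1 B1 g ->
  equivariant A0 B0 A1 B1 h -> g x = h x -> {in loopof A0 B0 x, g =1 h}.
Proof.
move=> /equivariantP[gA gB] /equivariantP[hA hB] /eqP gh y yx; apply/eqP; move: y yx.
by apply: (@loopof_closed _ A0 B0 (fun y => g y == h y)) gh => y /eqP E; rewrite ?gA ?hA ?gB ?hB E.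
Qed.

Lemma equivariant_loopof g x : equivariant A0 B0 A1 B1 g ->
  g @: loopof A0 B0 x = loopof A1 B1 (g x).
Proof.
move=> /equivariantP[gA gB]; apply/setP=> y; apply/imsetP/idP.
  case=> z zx ->; move: z zx.
  apply: (@loopof_closed _ A0 B0 (fun z => g z \in loopof A1 B1 (g x))) => [z|z|];
    last exact: mem_loopof; rewrite /= -!loopof_eq // => /eqP->; by rewrite ?gA ?gB ?loopofA ?loopofB.
move=> yx; have: y \in g @: loopof A0 B0 x; last by case/imsetP=> z; exists z.
move: y yx; apply: (@loopof_closed _ A1 B1 (mem (g @: loopof A0 B0 x)));
  last by apply: imset_f; exact: mem_loopof.
  move=> _ /imsetP[z zx ->]; rewrite -gA; apply: imset_f.
  by rewrite -loopof_eq // loopofA // loopof_eq.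
move=> _ /imsetP[z zx ->]; rewrite -gB; apply: imset_f.
by rewrite -loopof_eq // loopofB // loopof_eq.
Qed.

Lemma halfsize_embedding g x : equivariant A0 B0 A1 B1 g -> injective g ->
  halfsize A1 B1 (g x) = halfsize A0 B0 x.
Proof.
by move=> eg ig; rewrite /halfsize -equivariant_loopof // card_imset.
Qed.

Notation f0 := (fun x => A0 (B0 x)).
Notation f1 := (fun x => A1 (B1 x)).

(** The only candidate for an equivariant map on the loop of [x] that sends [x] to [y]: it follows
    the two cycles of [f0], starting at [x] and at [B0 x]. It is equivariant once the loops of [x]
    and [y] have the same half-size. *)
Definition loopmap (x : T0) (y : T1) (z : T0) : T1 :=
  if fconnect f0 x z then iter (findex f0 x z) f1 y
  else iter (findex f0 (B0 x) z) f1 (B1 y).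

Let f0_inj : injective f0.
Proof.
case/pairingP: pA0 pB0 => AK _ /pairingP[BK _] x y.
by move=> /(congr1 (B0 \o A0)); rewrite /= !AK !BK.
Qed.

Let f1_inj : injective f1.
Proof.
case/pairingP: pA1 pB1 => AK _ /pairingP[BK _] x y.
by move=> /(congr1 (B1 \o A1)); rewrite /= !AK !BK.
Qed.

Lemma iter_mod_order (T : finType) (f : T -> T) x i :
  injective f -> iter (i %% fingraph.order f x) f x = iter i f x.
Proof.
move=> fi; have E j : iter (j * fingraph.order f x) f x = x.
  by elim: j => // j IH; rewrite mulSn iterD IH iter_order.
by rewrite [in RHS](divn_eq i (fingraph.order f x)) addnC iterD E.
Qed.

Lemma findex_iter_mod (T : finType) (f : T -> T) x i :
  injective f -> findex f x (iter i f x) = i %% fingraph.order f x.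
Proof.
by move=> fi; rewrite -iter_mod_order // findex_iter // ltn_mod fingraph.order_gt0.
Qed.

Section LoopMap.

Variables (x : T0) (y : T1).
Hypothesis hs : halfsize A0 B0 x = halfsize A1 B1 y.

Let oxy : fingraph.order f0 x = fingraph.order f1 y.
Proof. by rewrite -!halfsizeE. Qed.

Lemma loopmap_iter i : loopmap x y (iter i f0 x) = iter i f1 y.
Proof.
by rewrite /loopmap fconnect_iter findex_iter_mod // oxy iter_mod_order.
Qed.

Lemma loopmap_iterB i : loopmap x y (iter i f0 (B0 x)) = iter i f1 (B1 y).
Proof.
rewrite /loopmap ifN; last first.
  apply/negP=> c; have /negP[] := loop_disj pA0 pB0 x; apply: (connect_trans c).
  by rewrite fconnect_sym // fconnect_iter.
by rewrite findex_iter_mod // loop_orderB // oxy -(@loop_orderB _ A1) // iter_mod_order.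
Qed.

Lemma loopmap_id : loopmap x y x = y. Proof. exact: (loopmap_iter 0). Qed.

Lemma loopmap_equiv : {in loopof A0 B0 x, forall z,
  loopmap x y (A0 z) = A1 (loopmap x y z) /\ loopmap x y (B0 z) = B1 (loopmap x y z)}.
Proof.
case/pairingP: (pA0) (pB0) => A0K _ /pairingP[B0K _].
case/pairingP: (pA1) (pB1) => A1K _ /pairingP[B1K _].
have os (T : finType) (f : T -> T) (fi : injective f) z n :
    fingraph.order f z = n -> iter n.-1.+1 f z = z.
  by move=> <-; rewrite prednK ?fingraph.order_gt0 // iter_order.
have o1 : fingraph.order f1 (B1 y) = fingraph.order f0 x by rewrite loop_orderB.
have o0 : fingraph.order f0 (B0 x) = fingraph.order f0 x by rewrite loop_orderB.
(* Since [A0] is [f0] after [B0], and likewise for [A1], both equations follow once [B0 z] and [B1]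
   of the image of [z] are the same iterate on the two sides. *)
have H z : z \in loopof A0 B0 x ->
    (exists i, (B0 z = iter i f0 x) /\ B1 (loopmap x y z) = iter i f1 y) \/
    (exists i, (B0 z = iter i f0 (B0 x)) /\ B1 (loopmap x y z) = iter i f1 (B1 y)).
  rewrite in_loopof // => /orP[] /iter_findex <-; set i := findex _ _ _; [right|left].
    rewrite loopmap_iter (loop_B_iter pA0 pB0 _ (os _ _ f0_inj _ _ erefl)).
    rewrite (loop_B_iter pA1 pB1 _ (os _ _ f1_inj _ _ (esym oxy))).
    by eexists.
  rewrite loopmap_iterB (loop_B_iter pA0 pB0 _ (os _ _ f0_inj _ _ o0)) B0K.
  rewrite (loop_B_iter pA1 pB1 _ (os _ _ f1_inj _ _ o1)) B1K.
  by eexists.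
move=> z /H[] [i [Ez E1]]; rewrite -[A0 z](congr1 A0 (B0K z)) Ez E1.
  rewrite -[A0 _]/(iter i.+1 f0 x) !loopmap_iter; split=> //.
  by rewrite /= -E1 B1K.
rewrite -[A0 _]/(iter i.+1 f0 (B0 x)) !loopmap_iterB; split=> //.
by rewrite /= -E1 B1K.
Qed.

End LoopMap.

End Equivariant.

(** The possible images of a list of loop representatives under an equivariant injection: half-sizes
    are preserved and distinct loops go to distinct loops. *)
Fixpoint looptuples (T : finType) (A B : T -> T) (ss : seq nat) : seq (seq T) :=
  if ss is s :: ss' then
    [seq y :: t | t <- looptuples A B ss',
       y <- enum [pred y | (halfsize A B y == s) &&
                           (loopof A B y \notin map (loopof A B) t)]]
  else [:: [::]].

(** With [m s] loops of half-size s available, a new image may be any of their 2s labels, except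
    those in loops already taken for [ss']. *)
Fixpoint loopcount (m : nat -> nat) (ss : seq nat) : nat :=
  if ss is s :: ss' then
    ((s.*2 * m s - s.*2 * count_mem s ss') * loopcount m ss')%N
  else 1%N.

Section LoopTuples.

Variables (T : finType) (A B : T -> T).
Hypotheses (pA : pairing A) (pB : pairing B).

Lemma mem_looptuples ss t : (t \in looptuples A B ss) =
  (map (halfsize A B) t == ss) && uniq (map (loopof A B) t).
Proof.
elim: ss t => [|s ss IH] t /=; first by case: t.
apply/allpairsPdep/andP => [[u [y [+ + ->]]] | ].
  by rewrite IH mem_enum inE /= => /andP[/eqP-> ->] /andP[/eqP-> ->].
case: t => [|y t] /=; first by case.
case=> /eqP[ey et] /andP[yt ut].
by exists t, y; rewrite IH et eqxx ut mem_enum inE ey eqxx yt.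
Qed.

Lemma looptuples_uniq ss : uniq (looptuples A B ss).
Proof.
elim: ss => //= s ss IH; apply: allpairs_uniq_dep => //.
  by move=> t _; exact: enum_uniq.
by move=> [t y] [t' y'] _ _ /= [-> ->].
Qed.

Lemma card_in_loops s (t : seq T) : uniq (map (loopof A B) t) ->
  #|[set y | (halfsize A B y == s) && (loopof A B y \in map (loopof A B) t)]| =
  (s.*2 * count_mem s (map (halfsize A B) t))%N.
Proof.
elim: t => [|z t IH] /=; first by rewrite muln0 => _; apply: eq_card0 => y; rewrite !inE andbF.
case/andP=> zt /IH {}IH; rewrite mulnDr -IH.
rewrite (_ : [set y | _] =
   (if halfsize A B z == s then loopof A B z else set0) :|:
   [set y | (halfsize A B y == s) && (loopof A B y \in map (loopof A B) t)]).
  rewrite cardsU (_ : _ :&: _ = set0) ?cards0 ?subn0.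
    by case: eqP => [<-|_]; rewrite ?card_loopofE ?muln1 ?cards0 ?muln0.
  apply/setP=> y; rewrite !inE; apply/negP=> /andP[+ /andP[_]].
  case: eqP => _; last by rewrite inE.
  by rewrite -loopof_eq // => /eqP <-; apply/negP.
apply/setP=> y; rewrite !inE andb_orr; congr orb.
rewrite [loopof A B y == _]eq_sym loopof_eq //.
case: (boolP (y \in loopof A B z)) => yz.
  by rewrite andbT (halfsize_in pA pB yz); case: eqP => _; rewrite ?yz ?inE.
by rewrite andbF; case: eqP => _; rewrite ?(negbTE yz) ?inE.
Qed.

Lemma size_looptuples ss :
  size (looptuples A B ss) = loopcount (fun s => count_mem s (looptype A B)) ss.
Proof.
elim: ss => //= s ss IH; rewrite size_allpairs_dep -IH.
set N := (_ - _)%N.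
rewrite (_ : map _ _ = map (fun=> N) (looptuples A B ss)).
  by elim: (looptuples A B ss) => [|t l IHl] /=; rewrite ?muln0 ?mulnS ?IHl.
apply/eq_in_map => t; rewrite mem_looptuples => /andP[/eqP et ut].
rewrite -cardE /N -card_halfsize // -et -card_in_loops //.
rewrite -[X in (X - _)%N](cardsID [set y | loopof A B y \in map (loopof A B) t]).
rewrite (_ : _ :&: _ = [set y | (halfsize A B y == s) && (loopof A B y \in map (loopof A B) t)]).
  by rewrite addKn; apply: eq_card => y; rewrite !inE andbC.
by apply/setP=> y; rewrite !inE.
Qed.

End LoopTuples.

Section Embeddings.

Variables (T0 T1 : finType) (A0 B0 : T0 -> T0) (A1 B1 : T1 -> T1).
Hypotheses (pA0 : pairing A0) (pB0 : pairing B0).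
Hypotheses (pA1 : pairing A1) (pB1 : pairing B1).

(** The image contains [y] and is stable under [A1] and [B1], so it covers the loop of [y], which
    has as many labels as the loop of [x]. *)
Lemma loopmap_inj x y : halfsize A0 B0 x = halfsize A1 B1 y ->
  {in loopof A0 B0 x &, injective (loopmap A0 B0 A1 B1 x y)}.
Proof.
move=> hs; apply/imset_injP; rewrite eqn_leq leq_imset_card /=.
rewrite card_loopofE // hs -card_loopofE //; apply/subset_leq_card/subsetP.
apply: (@loopof_closed _ A1 B1 (fun t => t \in loopmap A0 B0 A1 B1 x y @: loopof A0 B0 x)).
- move=> _ /imsetP[z zx ->]; have [<- _] := loopmap_equiv pA0 pB0 pA1 pB1 hs zx.
  by apply: imset_f; rewrite -loopof_eq // loopofA // loopof_eq.
- move=> _ /imsetP[z zx ->]; have [_ <-] := loopmap_equiv pA0 pB0 pA1 pB1 hs zx.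
  by apply: imset_f; rewrite -loopof_eq // loopofB // loopof_eq.
by rewrite -{1}(loopmap_id pA0 pB0 pA1 pB1 hs); apply: imset_f; apply: mem_loopof.
Qed.

Notation xs := (loopreps A0 B0).

Lemma embedding_exists (ys : seq T1) :
  map (halfsize A1 B1) ys = map (halfsize A0 B0) xs ->
  uniq (map (loopof A1 B1) ys) ->
  exists2 g : {ffun T0 -> T1}, equivariant A0 B0 A1 B1 g && injectiveb g & map g xs = ys.
Proof.
move=> hs uys; have szy : size ys = size xs by rewrite -(size_map (halfsize A1 B1)) hs size_map.
pose r := looprep A0 B0.
have rx z : r z \in xs by rewrite mem_loopreps looprep_id.
(* [T1] may be empty, so the default that [nth] requires is drawn from [ys], which is nonempty as
   soon as [T0] has a label. *)
have y0 (z : T0) : T1.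
  by move: (rx z) szy; case: {hs uys} ys => [|y ?] //; case: xs.
pose g := [ffun z => loopmap A0 B0 A1 B1 (r z) (nth (y0 z) ys (index (r z) xs)) z].
have hsr z : halfsize A0 B0 (r z) = halfsize A1 B1 (nth (y0 z) ys (index (r z) xs)).
  rewrite -(nth_map _ 0) ?szy ?index_mem // hs (nth_map z) ?index_mem //.
  by rewrite nth_index.
have rC z t : loopof A0 B0 z = loopof A0 B0 t -> r z = r t.
  by move=> E; apply/eqP; rewrite looprep_eq // E.
have gE z t : t \in loopof A0 B0 z -> g t = loopmap A0 B0 A1 B1 (r z) (nth (y0 z) ys (index (r z) xs)) t.
  rewrite -loopof_eq // => /eqP/rC E; rewrite ffunE E.
  by congr (loopmap _ _ _ _ _ _ _); apply: set_nth_default; rewrite szy index_mem.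
have zr z : z \in loopof A0 B0 (r z) by rewrite loopof_rep // mem_loopof.
have eg : equivariant A0 B0 A1 B1 g.
  apply/equivariantP; split=> z.
    have [E _] := loopmap_equiv pA0 pB0 pA1 pB1 (hsr z) (zr z).
    by rewrite (@gE z (A0 z)) ?E ?(@gE z z) ?mem_loopof // -loopof_eq // loopofA.
  have [_ E] := loopmap_equiv pA0 pB0 pA1 pB1 (hsr z) (zr z).
  by rewrite (@gE z (B0 z)) ?E ?(@gE z z) ?mem_loopof // -loopof_eq // loopofB.
have gr z : g (r z) = nth (y0 z) ys (index (r z) xs).
  by rewrite (gE z) ?looprep_in // loopmap_id.

have gl z : loopof A1 B1 (g z) = loopof A1 B1 (nth (y0 z) ys (index (r z) xs)).
  by rewrite -gr -!(equivariant_loopof pA0 pB0 pA1 pB1 _ eg) loopof_rep.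
have ig : injective g.
  move=> z t gzt.
  have rzt : r z = r t.
    have := gl z; rewrite gzt gl.
    rewrite -!(nth_map _ (loopof A1 B1 (y0 z))) ?szy ?index_mem //.
    move/eqP; rewrite nth_uniq ?size_map ?szy ?index_mem // => /eqP/esym E.
    by rewrite -(nth_index z (rx z)) E nth_index.
  have zt : t \in loopof A0 B0 z by rewrite -loopof_eq // -looprep_eq // -/r rzt.
  have := gzt; rewrite (gE z t) // (gE z z) ?mem_loopof //.
  apply: (loopmap_inj (hsr z)); first exact: zr.
  by rewrite rzt zr.
exists g; first by rewrite eg; apply/injectiveP.
have [x0 _ | xs0] := pickP (mem xs); last first.
  have E : xs = [::] by case: (xs) xs0 => // x s /(_ x); rewrite /= mem_head.
  by rewrite E; apply/esym/size0nil; rewrite szy E.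
apply: (@eq_from_nth _ (y0 x0)); rewrite ?size_map // => i ix.
have ni : nth x0 xs i \in xs by rewrite mem_nth.
rewrite (nth_map x0) //; have := ni; rewrite mem_loopreps => /eqP E.
rewrite -{1}E gr /r E index_uniq ?loopreps_uniq //.
by apply: set_nth_default; rewrite szy.
Qed.

(** An equivariant injection is determined by its values at the loop representatives, and every
    admissible tuple of values is attained. *)
Lemma card_embeddings :
  #|[set g : {ffun T0 -> T1} | equivariant A0 B0 A1 B1 g && injectiveb g]| =
  loopcount (fun s => count_mem s (looptype A1 B1)) (map (halfsize A0 B0) xs).
Proof.
set G := [set g | _]; rewrite -size_looptuples //.
rewrite cardE -(size_map (fun g : {ffun T0 -> T1} => map g xs)).
apply/perm_size/uniq_perm; last 2 first.
- exact: looptuples_uniq.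
- move=> t; rewrite mem_looptuples //; apply/mapP/andP => [[g] | [/eqP et ut]].
    rewrite mem_enum inE => /andP[eg /injectiveP ig] ->; split.
      apply/eqP; rewrite -map_comp; apply: eq_map => x /=.
      exact: (halfsize_embedding pA0 pB0 pA1 pB1).
    rewrite -map_comp map_inj_in_uniq ?loopreps_uniq // => x y xx xy /= E.
    have: loopof A0 B0 x = loopof A0 B0 y.
      by apply: (imset_inj ig); rewrite !(equivariant_loopof pA0 pB0 pA1 pB1 _ eg).
    by apply: loopof_rep_inj; rewrite ?inE -?mem_loopreps.
  by have [g gG <-] := embedding_exists et ut; exists g => //; rewrite mem_enum inE.
rewrite map_inj_in_uniq ?enum_uniq // => g h; rewrite !mem_enum !inE.
move=> /andP[eg _] /andP[eh _] E; apply/ffunP=> z.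
have zr : z \in loopof A0 B0 (looprep A0 B0 z) by rewrite loopof_rep // mem_loopof.
apply: (equivariant_ext eg eh _ zr).
have := @looprep_id _ _ _ pA0 pB0 z => /eqP; rewrite -mem_loopreps => rx.
move/(congr1 (fun s => nth (g z) s (index (looprep A0 B0 z) xs))): E.
by rewrite !(nth_map z) ?index_mem // nth_index.
Qed.

End Embeddings.

Lemma loopcountE (m : nat -> nat) (ss : seq nat) (K : nat) :
  all (fun s => s < K)%N ss ->
  loopcount m ss =
  (\prod_(i < K) (i.*2 ^ count_mem (i : nat) ss * m i ^_ count_mem (i : nat) ss))%N.
Proof.
elim: ss => [|s ss IH] /=; first by move=> _; rewrite big1.
case/andP=> sK /IH ->; rewrite -mulnBr.
transitivity (\prod_(i < K) (if i == Ordinal sK then s.*2 * (m s - count_mem s ss) else 1) *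
   \prod_(i < K) (i.*2 ^ count_mem (i : nat) ss * m i ^_ count_mem (i : nat) ss))%N.
  by congr (_ * _)%N; rewrite -big_mkcond big_pred1_eq.
rewrite -big_split; apply: eq_bigr => i _ /=.
rewrite -val_eqE /= [s == i]eq_sym; case: eqP => [->|_]; last by rewrite mul1n add0n.
by rewrite add1n expnS ffactnSr; lia.
Qed.

Lemma zeeE (mu : seq nat) (K : nat) : all (fun s => s < K)%N mu ->
  zee mu = (\prod_(i < K) (i ^ count_mem (i : nat) mu * (count_mem (i : nat) mu)`!))%N.
Proof.
move=> /allP muK; rewrite /zee /mult.
rewrite -(big_mkord xpredT (fun i => i ^ count_mem i mu * (count_mem i mu)`!)%N).
rewrite [RHS](bigID (mem mu)) /= [X in (_ * X)%N]big1 ?muln1; last first.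
  by move=> i /count_memPn ->.
rewrite -[RHS]big_filter; apply: perm_big; apply: uniq_perm.
- exact: undup_uniq.
- by rewrite filter_uniq ?iota_uniq.
move=> i; rewrite mem_undup mem_filter mem_index_iota /=.
by case: (boolP (i \in mu)) => // /muK ->.
Qed.

Lemma sum_count_mem (s : seq nat) (K : nat) : all (fun i => i < K)%N s ->
  (\sum_(i < K) count_mem (i : nat) s)%N = size s.
Proof.
elim: s => [|x s IH] /=; first by rewrite big1.
case/andP=> xK /IH {}IH; rewrite big_split /= IH (bigD1 (Ordinal xK)) //= eqxx.
by rewrite big1 // => i; rewrite -val_eqE /= eq_sym => /negbTE ->.
Qed.

(** The factors 2i give the power of two and the powers of i in [zee]. The number of ordered choices
    of loops is the factorial of the multiplicity, except for the part 1, where j extra loops are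
    available: this is the origin of the binomial coefficient in [Sigma2]. *)
Lemma loopcount_extended (mu ss : seq nat) (j : nat) : perm_eq ss mu ->
  loopcount (fun s => count_mem s (mu ++ nseq j 1%N)) ss =
  (2 ^ size mu * zee mu * 'C(j + mult 1 mu, mult 1 mu))%N.
Proof.
move=> pss; have /seq.permP css := pss.
(* A strict bound on the parts, taken at least 2 so that the index 1 occurs in the products. *)
pose K := (maxn 2 (\max_(s <- mu) s).+1).
have muK : all (fun s => s < K)%N mu.
  apply/allP=> s smu; rewrite /K leq_max ltnS; apply/orP; right.
  exact: leq_bigmax_seq.
have K1 : (1 < K)%N by rewrite /K leq_max.
have ssK : all (fun s => s < K)%N ss by rewrite (perm_all _ pss).
rewrite (loopcountE _ ssK) (zeeE muK) -(sum_count_mem muK) expn_sum -big_split /=.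
have -> : 'C(j + mult 1 mu, mult 1 mu) =
    (\prod_(i < K) (if i == Ordinal K1 then 'C(j + mult 1 mu, mult 1 mu) else 1))%N.
  by rewrite -big_mkcond big_pred1_eq.
rewrite -big_split; apply: eq_bigr => i _ /=.
rewrite css count_cat count_nseq -bin_ffact -muln2 expnMn.
rewrite -val_eqE /= [1%N == i]eq_sym; case: eqP => [->|_].
  by rewrite mul1n /mult [(count_mem _ _ + j)%N]addnC; ring.
by rewrite mul0n addn0 binn; ring.
Qed.

Lemma loopcount_self (mu ss : seq nat) : perm_eq ss mu ->
  loopcount (fun s => count_mem s mu) ss = (2 ^ size mu * zee mu)%N.
Proof.
move=> /(loopcount_extended 0); rewrite /= cats0 add0n binn muln1 => <-.
by [].
Qed.

Section Decomposition.

Variables (T0 T1 : finType) (A0 B0 : T0 -> T0) (A1 B1 : T1 -> T1).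
Hypotheses (pA0 : pairing A0) (pB0 : pairing B0).
Hypotheses (pA1 : pairing A1) (pB1 : pairing B1).

(** The image of [g] accounts for the type of the source. The 2j labels left over contribute j parts
    equal to 1 exactly when each of them has half-size 1, that is, when the two pairings agree
    there. For [j = 0] this gives the invariance of the type under isomorphism. *)
Lemma looptype_decomp (g : T0 -> T1) (j : nat) :
  equivariant A0 B0 A1 B1 g -> injective g -> (#|T1| = #|T0| + j.*2)%N ->
  perm_eq (looptype A1 B1) (looptype A0 B0 ++ nseq j 1%N) <->
  (forall y, y \notin codom g -> A1 y = B1 y).
Proof.
move=> eg ig cT.
pose off i := #|[set y | (y \notin codom g) && (halfsize A1 B1 y == i)]|.
have cnt i : #|[set y | halfsize A1 B1 y == i]| =
    (#|[set x | halfsize A0 B0 x == i]| + off i)%N.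
  rewrite -(cardsID [set y in codom g]); congr (_ + _)%N.
    rewrite -(card_imset _ ig); apply: eq_card => y; rewrite !inE.
    apply/andP/imsetP=> [[hy /codomP[x Ex]] | [x + ->]].
      by exists x; rewrite // inE -(halfsize_embedding pA0 pB0 pA1 pB1 x eg ig) -Ex.
    by rewrite inE -(halfsize_embedding pA0 pB0 pA1 pB1 x eg ig) codom_f.
  by apply: eq_card => y; rewrite !inE.
have coff : #|[set y | y \notin codom g]| = j.*2.
  have := cardsC [set y in codom g]; rewrite cT cardsE card_codom // => /addnI <-.
  by apply: eq_card => y; rewrite !inE.
have pos : all (fun i => 0 < i)%N (looptype A0 B0 ++ nseq j 1%N).
  rewrite all_cat looptype_pos //=; apply/allP => i; rewrite mem_nseq.
  by case/andP=> _ /eqP->.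
rewrite -perm_looptypeP //; split=> [H y yg | H i].
  have := H 1%N; rewrite cnt card_halfsize // count_cat count_nseq mulnDr => /addnI.
  rewrite /= mul1n mul2n -coff => E.
  have /eqP/setP/(_ y) : [set y | (y \notin codom g) && (halfsize A1 B1 y == 1%N)] ==
       [set y | y \notin codom g].
    rewrite eqEcard -/(off 1%N) E leqnn andbT; apply/subsetP=> z; by rewrite !inE => /andP[].
  by rewrite !inE yg halfsize1 // => /eqP.
rewrite cnt card_halfsize // count_cat count_nseq mulnDr; congr (_ + _)%N.
rewrite /off; case: (eqVneq i 1%N) => [-> | i1] /=.
  rewrite mul1n mul2n -coff; apply: eq_card => y; rewrite !inE.
  by case: (boolP (y \in codom g)) => //= /H E; rewrite halfsize1 // E eqxx.
rewrite eq_sym (negbTE i1) mul0n muln0; apply: eq_card0 => y; rewrite !inE.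
case: (boolP (y \in codom g)) => //= /H /eqP; rewrite -halfsize1 // => /eqP->.
by rewrite eq_sym (negbTE i1).
Qed.

End Decomposition.

(** * Functions constant on loops, and signs *)

Definition loopconst (T V : finType) (A B : T -> T) (h : T -> V) : bool :=
  [forall x, (h (A x) == h x) && (h (B x) == h x)].

Lemma loopconstP (T V : finType) (A B : T -> T) (h : T -> V) :
  reflect ((forall x, h (A x) = h x) /\ (forall x, h (B x) = h x)) (loopconst A B h).
Proof.
apply: (iffP forallP) => [H | [H1 H2] x]; last by rewrite H1 H2 !eqxx.
by split=> x; case/andP: (H x) => /eqP ? /eqP ?.
Qed.

Lemma loopconst_rep (T V : finType) (A B : T -> T) (h : T -> V) x :
  pairing A -> pairing B -> loopconst A B h -> h (looprep A B x) = h x.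
Proof.
by move=> pA pB /loopconstP[hA hB]; apply: loopof_const hA hB _ _ (looprep_in _ _ _).
Qed.

(** A function constant on loops is a free choice of one value per representative, so this is
    distributivity. *)
Lemma sum_loopconst (R : comPzSemiRingType) (T V : finType) (A B : T -> T)
    (F : T -> V -> R) : pairing A -> pairing B ->
  (\sum_(h : {ffun T -> V} | loopconst A B h)
     \prod_(x | looprep A B x == x) F x (h x) =
   \prod_(x | looprep A B x == x) \sum_v F x v)%R.
Proof.
(* Distributivity asks for a default value. If [V] is empty, both sides are 0 when [T] has a label
   and 1 when it has none. *)
move=> pA pB; have [v0 _ | V0] := pickP (@predT V); last first.
  have [x _ | T0] := pickP (@predT T).
    rewrite [RHS](bigD1 (looprep A B x)) /=; last by rewrite looprep_id.
    rewrite [X in (X * _)%R]big_pred0 ?mul0r; last by move=> v; have := V0 v.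
    by rewrite big1 // => h _; have := V0 (h x).
  rewrite [RHS]big_pred0; last by move=> x; have := T0 x.
  have h0 : {ffun T -> V} by apply: finfun => x; have := T0 x.
  rewrite (big_pred1 h0) ?big_pred0 //; first by move=> x; have := T0 x.
  move=> h; rewrite /= (_ : h = h0) ?eqxx; first by apply/loopconstP; split=> x; have := T0 x.
  by apply/ffunP=> x; have := T0 x.
rewrite (big_distr_big_dep v0).
rewrite (reindex_onto (fun f : {ffun T -> V} => [ffun x => f (looprep A B x)])
          (fun h : {ffun T -> V} => [ffun x => if looprep A B x == x then h x else v0])) /=; last first.
  move=> h hc; apply/ffunP=> x; rewrite !ffunE looprep_id // eqxx.
  exact: loopconst_rep.
apply: eq_big => [f|f _]; last first.
  by apply: eq_bigr => x /eqP E; rewrite ffunE E.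
rewrite (_ : loopconst _ _ _) /=; last first.
  apply/loopconstP; split=> x; rewrite !ffunE; congr (f _); apply/eqP;
    by rewrite looprep_eq // ?loopofA ?loopofB.
apply/eqP/pfamilyP=> [<-|[sf _]].
  split=> //; apply/supportP=> x; rewrite unfold_in ffunE => /negbTE E.
  by rewrite E.
apply/ffunP=> x; rewrite !ffunE; case: ifP => [/eqP->//|E].
by move/supportP: sf => /(_ x) -> //; rewrite unfold_in E.
Qed.

Lemma loopof_sym (T : finType) (A B : T -> T) : loopof A B =1 loopof B A.
Proof.
by move=> x; apply/setP=> y; rewrite !inE; apply: eq_connect => u v /=; rewrite orbC.
Qed.

Lemma loopset_sym (T : finType) (A B : T -> T) : loopset A B = loopset B A.
Proof. by apply: eq_imset => x; exact: loopof_sym. Qed.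

Definition swapconj (T : finType) (a b : T) (A : T -> T) (x : T) : T :=
  tperm a b (A (tperm a b x)).

Lemma pairing_swapconj (T : finType) (a b : T) (A : T -> T) :
  pairing A -> pairing (swapconj a b A).
Proof.
case/pairingP=> AK An; apply/pairingP; rewrite /swapconj; split=> x.
  by rewrite tpermK AK tpermK.
by rewrite -[X in _ != X](tpermK a b) (inj_eq perm_inj) An.
Qed.

Section Sign.

Variables (T : finType) (chi : T -> bool) (A B : T -> T).
Hypotheses (pA : pairing A) (pB : pairing B).
Hypotheses (chiA : forall x, chi (A x) = ~~ chi x) (chiB : forall x, chi (B x) = ~~ chi x).

(** Being the identity on the other colour class makes it a permutation of all of [T], to which
    [odd_perm] applies. *)
Definition halfturn (x : T) : T := if chi x then A (B x) else x.

Lemma halfturn_inj : injective halfturn.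
Proof.
case/pairingP: pA pB => AK _ /pairingP[BK _] x y; rewrite /halfturn.
case: ifP => cx; case: ifP => cy //.
- by move=> /(congr1 (B \o A)); rewrite /= !AK !BK.
- by move=> E; rewrite -E chiA chiB cx in cy.
- by move=> E; rewrite E chiA chiB cy in cx.
Qed.

(** Both pairings switch colours, so a loop meets the class [chi] in exactly one cycle of [A] after
    [B]; every label of the other class is a cycle by itself. *)
Lemma card_porbits_halfturn :
  #|porbits (perm halfturn_inj)| = (#|loopset A B| + #|[set x | ~~ chi x]|)%N.
Proof.
set t := perm _; have tE x : t x = halfturn x by rewrite permE.
have pF x : ~~ chi x -> porbit t x = [set x].
  move=> cx; apply/setP=> y; rewrite inE; apply/porbitP/eqP => [[i ->]|->]; last by exists 0; rewrite perm1.
  by elim: i => [|i IH]; rewrite ?perm1 // expgSr permM IH tE /halfturn (negbTE cx).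
have pT x : chi x -> porbit t x = loopof A B x :&: [set y | chi y].
  move=> cx; apply/setP=> y; rewrite !inE; apply/porbitP/andP=> [[i ->] | [yx cy]].
    elim: i => [|i [IH1 IH2]]; first by rewrite perm1 cx connect0.
    rewrite expgSr permM tE /halfturn IH2 chiA chiB negbK IH2; split=> //.
    have : (t ^+ i)%g x \in loopof A B x by rewrite inE.
    rewrite -loopof_eq // => E.
    have : A (B ((t ^+ i)%g x)) \in loopof A B x by rewrite -loopof_eq // loopofA // loopofB.
    by rewrite inE.
  have : y \in loopof A B x by rewrite inE.
  rewrite in_loopof //; set f := (fun x => A (B x)).
  have chif z i : chi (iter i f z) = chi z.
    by elim: i => //= i <-; rewrite chiA chiB negbK.
  case/orP=> /iter_findex E; last first.
    by move: cy; rewrite -E chif chiB cx.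
  exists (findex f x y); rewrite -[LHS]E.
  elim: (findex f x y) => [|i IH]; first by rewrite perm1.
  by rewrite expgSr permM -IH tE /halfturn chif cx.
have -> : porbits t = [set [set x] | x in [set x | ~~ chi x]] :|:
    [set l :&: [set y | chi y] | l : {set T} in loopset A B].
  apply/setP=> c; rewrite inE; apply/imsetP/orP => [[x _ ->]|].
    case: (boolP (chi x)) => cx; [right|left].
      by rewrite pT //; apply: imset_f; apply: imset_f.
    by rewrite pF //; apply: imset_f; rewrite inE.
  case=> /imsetP[].
    by move=> x; rewrite inE => cx ->; exists x; rewrite ?pF.
  move=> _ /imsetP[x _ ->] ->; case: (boolP (chi x)) => cx.
    by exists x; rewrite ?pT.
  by exists (B x); rewrite ?pT ?chiB // loopofB.
rewrite cardsU (_ : _ :&: _ = set0) ?cards0 ?subn0; last first.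
  apply/setP=> c; rewrite !inE; apply/negP=> /andP[/imsetP[x +] -> /imsetP[l _]].
  by rewrite inE => cx /setP/(_ x); rewrite !inE eqxx (negbTE cx) andbF.
rewrite addnC (card_imset _ set1_inj) card_in_imset //.
move=> _ _ /imsetP[x _ ->] /imsetP[y _ ->] E.
wlog cx : x E / chi x => [H|].
  case: (boolP (chi x)) => cx; first exact: H.
  by rewrite -(loopofB pA pB x); apply: H; rewrite ?chiB // loopofB.
have : x \in loopof A B x :&: [set y | chi y] by rewrite inE mem_loopof inE.
by rewrite E inE -loopof_eq // => /andP[/eqP].
Qed.

End Sign.

(* The cycles of [x |-> A (B x)] on one colour class are the loops, so conjugating A by a
   transposition inside that class multiplies a permutation by a transposition. *)
Lemma odd_loopset_swapconj (T : finType) (chi : T -> bool) (A B : T -> T) (a b : T) :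
  pairing A -> pairing B ->
  (forall x, chi (A x) = ~~ chi x) -> (forall x, chi (B x) = ~~ chi x) ->
  chi a = chi b -> a != b ->
  odd #|loopset (swapconj a b A) B| = ~~ odd #|loopset A B|.
Proof.
move=> pA pB chiA chiB cab ab.
wlog ca : chi chiA chiB cab / chi a => [H|].
  case: (boolP (chi a)) => ca; first exact: (H chi).
  by apply: (H (fun x => ~~ chi x)); rewrite ?cab -?cab // => x /=; rewrite ?chiA ?chiB.
have cb : chi b by rewrite -cab.
have chit x : chi (tperm a b x) = chi x by case: tpermP => // ->; rewrite cab.
have chiA' x : chi (swapconj a b A x) = ~~ chi x by rewrite /swapconj chit chiA chit.
have pA' := pairing_swapconj a b pA.
have E : perm (halfturn_inj pA' pB chiA' chiB) = (perm (halfturn_inj pA pB chiA chiB) * tperm a b)%g.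
  apply/permP=> x; rewrite permM !(permE (halfturn_inj _ _ _ _)) /halfturn /swapconj.
  have nf y : ~~ chi y -> tperm a b y = y.
    by move=> cy; rewrite tpermD //; apply: contraNneq cy => <-.
  case: ifP => cx; first by rewrite (nf (B x)) ?chiB ?cx.
  by rewrite nf ?cx.
have := congr1 (@odd_perm _) E; rewrite odd_permM odd_tperm ab /odd_perm /=.
rewrite !card_porbits_halfturn !oddD.
by case: (odd #|T|) (odd #|loopset A B|) (odd #|[set x | ~~ chi x]|)
  (odd #|loopset (swapconj a b A) B|) => [] [] [] [].
Qed.

(** Each loop consists of two cycles of [A] after [B], exchanged by either pairing; [chi] marks the
    one through the representative. *)
Lemma orientation_exists (T : finType) (A B : T -> T) : pairing A -> pairing B ->
  exists chi : {ffun T -> bool}, (forall x, chi (A x) = ~~ chi x) /\ (forall x, chi (B x) = ~~ chi x).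
Proof.
move=> pA pB; case/pairingP: (pA) (pB) => AK _ /pairingP[BK _].
set f := (fun x => A (B x)).
have fi : injective f by move=> x y /(congr1 (B \o A)); rewrite /f /= !AK !BK.
pose chi := [ffun x => fconnect f (looprep A B x) x].
have rC x y : loopof A B x = loopof A B y -> looprep A B x = looprep A B y.
  by move=> E; apply/eqP; rewrite looprep_eq // E.
have os z n : fingraph.order f z = n -> iter n.-1.+1 f z = z.
  by move=> <-; rewrite prednK ?fingraph.order_gt0 // iter_order.
have chiB x : chi (B x) = ~~ chi x.
  rewrite !ffunE (rC (B x) x) ?loopofB //; set r := looprep A B x.
  have : x \in loopof A B r by rewrite loopof_rep // mem_loopof.
  rewrite in_loopof // -/f; case/orP=> /[dup] c /iter_findex <-.
    rewrite fconnect_iter (loop_B_iter pA pB _ (os _ _ erefl)) -/f.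
    apply/negP=> d; have /negP[] := loop_disj pA pB r; apply: (connect_trans d).
    by rewrite fconnect_sym // fconnect_iter.
  rewrite (loop_B_iter pA pB _ (os _ _ erefl)) BK -/f fconnect_iter.
  apply/esym/negP=> d; have /negP[] := loop_disj pA pB r; apply: (connect_trans d).
  by rewrite fconnect_sym // fconnect_iter.
exists chi; split=> // x; rewrite -chiB -{1}(BK x) -/(f (B x)) !ffunE.
rewrite (rC (f (B x)) (B x)) ?loopofA ?loopofB // -same_fconnect1_r //.
Qed.

(** * Pairings of given type *)

Definition pairlower (T : finType) (S : T -> T) (x : T) : bool :=
  (enum_rank x < enum_rank (S x))%N.

Lemma pairlowerN (T : finType) (S : T -> T) x : pairing S ->
  pairlower S (S x) = ~~ pairlower S x.
Proof.
case/pairingP=> SK Sn; rewrite /pairlower SK -leqNgt [in RHS]leq_eqVlt.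
by rewrite (inj_eq (@ord_inj _)) (inj_eq enum_rank_inj) (negbTE (Sn x)).
Qed.

Lemma card_pairlower (T I : finType) (S : T -> T) (f : T -> I) i :
  pairing S -> (forall x, f (S x) = f x) ->
  #|[set x | f x == i]| = (#|[set x | (f x == i) && pairlower S x]|).*2.
Proof.
move=> pS fS; have /pairingP[SK _] := pS.
rewrite -(cardsID [set x | pairlower S x]) -addnn; congr (_ + _)%N.
  by apply: eq_card => x; rewrite !inE.
set L := [set x | _ & _].
rewrite -(card_imset L (can_inj SK)); congr #|pred_of_set _|; apply/setP=> x.
rewrite -{2}(SK x) (mem_imset _ _ (can_inj SK)) !inE fS pairlowerN // andbC.
by case: (pairlower S x); rewrite ?andbF.
Qed.

(** The lower labels of the pairs are matched colour by colour through their enumerations, and the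
    upper labels follow by commutation with the pairings. *)
Lemma pairing_transport (T T' I : finType) (S : T -> T) (S' : T' -> T')
    (f : T -> I) (f' : T' -> I) :
  pairing S -> pairing S' ->
  (forall x, f (S x) = f x) -> (forall y, f' (S' y) = f' y) ->
  (forall i, #|[set x | f x == i]| = #|[set y | f' y == i]|) ->
  exists g : T -> T', [/\ injective g, forall x, g (S x) = S' (g x) & forall x, f' (g x) = f x].
Proof.
pose L (U : finType) (R : U -> U) (k : U -> I) i := [set x | (k x == i) && pairlower R x].
move=> pS pS' fS f'S' cf.
have /pairingP[SK _] := pS; have /pairingP[S'K _] := pS'.
have cL i : #|L T S f i| = #|L T' S' f' i|.
  by apply: double_inj; rewrite -!card_pairlower.
have y0 (x : T) : T'.
  have : exists y, f' y == f x.
    have : (0 < #|[set y | f' y == f x]|)%N.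
      by rewrite -cf card_gt0; apply/set0Pn; exists x; rewrite inE.
    by rewrite card_gt0 => /set0Pn[y]; rewrite inE; exists y.
  exact: xchoose.
pose b x := nth (y0 x) (enum (L T' S' f' (f x))) (index x (enum (L T S f (f x)))).
have bL x : pairlower S x -> b x \in L T' S' f' (f x).
  move=> lx; rewrite -mem_enum mem_nth // -cardE -cL cardE index_mem mem_enum.
  by rewrite !inE eqxx.
have bI x y : pairlower S x -> pairlower S y -> b x = b y -> x = y.
  move=> lx ly bxy; have fxy : f x = f y.
    by have := bL x lx; have := bL y ly; rewrite bxy !inE => /andP[/eqP-> _] /andP[/eqP-> _].
  have mx : x \in enum (L T S f (f x)) by rewrite mem_enum !inE eqxx.
  have my : y \in enum (L T S f (f x)) by rewrite mem_enum !inE fxy eqxx.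
  have sz : size (enum (L T' S' f' (f x))) = size (enum (L T S f (f x))) by rewrite -!cardE cL.
  move: bxy; rewrite /b -fxy (set_nth_default (y0 x) (y0 y)) ?sz ?index_mem // => /eqP.
  rewrite nth_uniq ?enum_uniq ?sz ?index_mem // => /eqP E.
  by rewrite -(nth_index x mx) E nth_index.
pose g x := if pairlower S x then b x else S' (b (S x)).
have gS x : g (S x) = S' (g x).
  by rewrite /g pairlowerN // SK; case: (pairlower S x); rewrite //= S'K.
have f'g x : f' (g x) = f x.
  rewrite /g; case: ifP => lx; first by have := bL x lx; rewrite inE => /andP[/eqP].
  have := bL (S x); rewrite pairlowerN // lx inE f'S' => /(_ isT) /andP[/eqP-> _].
  exact: fS.
have lg x : pairlower S' (g x) = pairlower S x.
  rewrite /g; case: ifP => lx; first by have := bL x lx; rewrite inE => /andP[_ ->].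
  rewrite pairlowerN //; have := bL (S x); rewrite pairlowerN // lx inE => /(_ isT) /andP[_ ->].
  by [].
exists g; split=> // x y gxy.
have lxy : pairlower S x = pairlower S y by rewrite -!lg gxy.
have gE z : pairlower S z -> g z = b z by rewrite /g => ->.
case lx: (pairlower S x).
  by apply: bI; rewrite -?lxy // -!gE -?lxy.
apply: (can_inj SK); apply: bI; rewrite ?pairlowerN -?lxy ?lx //.
by rewrite -!gE ?pairlowerN -?lxy ?lx // !gS gxy.
Qed.

(* The boxes of the diagram of [2 * la]: the box [(i, c)] of [la] is split into two halves,
   which [domino] exchanges. *)
Definition diagram (la : seq nat) : finType :=
  {i : 'I_(size la) & ('I_(nth 0 la i) * bool)%type}.

Definition box (la : seq nat) (i : 'I_(size la)) (c : 'I_(nth 0 la i)) (s : bool) : diagram la :=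
  existT (fun i : 'I_(size la) => ('I_(nth 0 la i) * bool)%type) i (c, s).

Definition drow (la : seq nat) (x : diagram la) : 'I_(size la) := tag x.
Definition dcol (la : seq nat) (x : diagram la) : nat := (tagged x).1.
Definition dside (la : seq nat) (x : diagram la) : bool := (tagged x).2.

Definition domino (la : seq nat) (x : diagram la) : diagram la :=
  let: existT i (c, s) := x in box c (~~ s).

Lemma diagram_ext (la : seq nat) (x y : diagram la) :
  drow x = drow y -> dcol x = dcol y -> dside x = dside y -> x = y.
Proof.
case: x y => [i [c s]] [j [d t]]; rewrite /drow /dcol /dside /= => ij.
by case: j / ij d => d /= /val_inj -> ->.
Qed.

Lemma drow_domino la (x : diagram la) : drow (domino x) = drow x.
Proof. by case: x => [i [c s]]. Qed.
Lemma dcol_domino la (x : diagram la) : dcol (domino x) = dcol x.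
Proof. by case: x => [i [c s]]. Qed.
Lemma dside_domino la (x : diagram la) : dside (domino x) = ~~ dside x.
Proof. by case: x => [i [c s]]. Qed.

Lemma pairing_domino la : pairing (@domino la).
Proof.
apply/pairingP; split=> [[i [c s]]|x]; first by rewrite /= negbK.
by apply/eqP=> /(congr1 (@dside la)); rewrite dside_domino; case: dside.
Qed.

Lemma card_drow la i : #|[set x : diagram la | drow x == i]| = (nth 0 la i).*2.
Proof.
have bI : injective (fun u : 'I_(nth 0 la i) * bool => box u.1 u.2).
  by move=> [c s] [d t] /eqP; rewrite eq_Tagged /= => /eqP [-> ->].
rewrite -muln2 -card_bool -{1}(card_ord (nth 0 la i)) -card_prod -cardsT -(card_imset _ bI).
apply: eq_card => -[j [c s]]; rewrite inE /drow /=; apply/eqP/imsetP => [ji|[u _]].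
  by case: i / ji bI => _; exists (c, s).
by move/(congr1 (@drow la)).
Qed.

Lemma card_diagram la : #|diagram la| = (sumn la).*2.
Proof.
rewrite -sum1_card (partition_big (@drow la) xpredT) //=.
under eq_bigr => i _.
  rewrite sum1_card -cardsE card_drow; over.
rewrite -(big_mkord xpredT (fun i => (nth 0 la i).*2)) -(big_nth 0 xpredT (fun i => i.*2)).
by elim: la => [|x s IH]; rewrite ?big_nil // big_cons IH /= doubleD.
Qed.

(** Joins the [true] half of a box to the [false] half of the next box of its row, cyclically.
    Together with [domino] this makes each row a single loop, which provides a model of the type
    [la]. *)
Definition rowshift (la : seq nat) (x : diagram la) : diagram la :=
  let: existT i (c, s) := x in
  if s then box (ordS c) false else box (ord_pred c) true.

Lemma pairing_rowshift la : pairing (@rowshift la).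
Proof.
apply/pairingP; split=> [[i [c []]]|[i [c s]]] /=; rewrite ?ordSK ?ord_predK //.
by apply/eqP=> /(congr1 (@dside la)); case: s.
Qed.

Lemma loopof_rowshift la (x : diagram la) :
  loopof (@domino la) (@rowshift la) x = [set y | drow y == drow x].
Proof.
have pd := pairing_domino la; have pr := pairing_rowshift la.
apply/setP=> y; rewrite inE; apply/idP/eqP=> [|yx].
  apply: (@loopof_const _ _ _ _ (@drow la)) => z; first exact: drow_domino.
  by case: z => [i [c []]].
rewrite -loopof_eq //; set lo := loopof _ _.
have side i c : lo (@box la i c true) = lo (box c false).
  by rewrite /lo -(loopofA pd pr).
have step (i : 'I_(size la)) (m : nat) (m1 : (m.+1 < nth 0 la i)%N) (m0 : (m < nth 0 la i)%N):
    lo (box (Ordinal m1) false) = lo (box (Ordinal m0) false).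
  rewrite -(side _ (Ordinal m0)) /lo -(loopofB pd pr (box (Ordinal m0) true)); congr loopof => /=.
  by congr box; apply: val_inj; rewrite /= modn_small.
have base (i : 'I_(size la)) (c : 'I_(nth 0 la i)) s (z0 : (0 < nth 0 la i)%N) :
    lo (box c s) = lo (box (Ordinal z0) false).
  transitivity (lo (box c false)); first by case: s => //.
  case: c => m; elim: m => [|m IH] mlt; first by congr (lo (box _ _)); apply: val_inj.
  by rewrite (step _ _ _ (ltnW mlt)) IH.
case: x y yx => [i [c s]] [j [d t]]; rewrite /drow /= => ji.
case: i / ji c => c.
have z0 := leq_ltn_trans (leq0n c) (ltn_ord c).
by rewrite /= (base _ c s z0) (base _ d t z0).
Qed.

Lemma looptype_rowshift (la : seq nat) n : is_partition n la ->
  looptype (@domino la) (@rowshift la) = la.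
Proof.
case/and3P=> sla la0 _.
apply: sorted_perm_eq => //; first exact: looptype_sorted.
have pd := pairing_domino la; have pr := pairing_rowshift la.
have hs x : halfsize (@domino la) (@rowshift la) x = nth 0 la (drow x).
  by rewrite /halfsize loopof_rowshift card_drow -muln2 mulnK.
apply/perm_looptypeP => // s.
rewrite -sum1_card (partition_big (@drow la) xpredT) //=.
rewrite -sum1_count [in RHS]big_mkcond (big_nth 0) big_mkord big_distrr /=.
apply: eq_bigr => i _.
transitivity (\sum_(x | drow x == i) (if nth 0 la i == s then 1 else 0))%N.
  rewrite [in LHS]big_mkcond [in RHS]big_mkcond; apply: eq_bigr => x _.
  by rewrite inE hs; case: (eqVneq (drow x) i) => [->|]; rewrite ?andbF ?andbT.
rewrite sum_nat_const -cardsE card_drow.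
by case: eqP => [->|]; rewrite ?muln0 ?muln1.
Qed.

Lemma pairing_type_exists (T : finType) (S : T -> T) (n : nat) (r : seq nat) :
  pairing S -> #|T| = n.*2 -> is_partition n r ->
  exists B : T -> T, pairing B /\ looptype S B = r.
Proof.
move=> pS cT pr; have /and3P[sr r0 /eqP nr] := pr.
have pd := pairing_domino r; have pw := pairing_rowshift r.
have cD : #|T| = #|diagram r| by rewrite card_diagram nr.
have [|g [ig gS _]] := @pairing_transport _ _ _ _ S (fun=> tt) (fun=> tt) pd pS (fun=> erefl) (fun=> erefl).
  by case; rewrite !(eq_card (B := predT)) ?cD // => x; rewrite inE eqxx.
have [g' gK g'K] : bijective g by apply: inj_card_bij; rewrite ?cD.
have /pairingP[wK wn] := pw.
pose B x := g (rowshift (g' x)).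
have pB : pairing B.
  apply/pairingP; rewrite /B; split=> x; first by rewrite gK wK g'K.
  by rewrite -[X in _ != X]g'K (inj_eq ig) wn.
exists B; split=> //; rewrite -(looptype_rowshift pr).
apply: sorted_perm_eq; try exact: looptype_sorted.
rewrite -[X in perm_eq _ X]cats0; apply/(looptype_decomp (j := 0) pd pw pS pB (g := g)) => //.
- by apply/equivariantP; split=> x; rewrite // /B gK.
- by rewrite addn0.
by move=> y /codomP[]; exists (g' y); rewrite g'K.
Qed.

(** For a pairing [S] this is the hyperoctahedral group. *)
Definition commutant (T : finType) (S : T -> T) : {set {ffun T -> T}} :=
  [set g : {ffun T -> T} | injectiveb g && [forall x, g (S x) == S (g x)]].

(** Orbit-stabilizer: each [g] commuting with [S] carries a fixed [B] of type [r] to one pairing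
    [S'], and each [S'] of type [r] is reached by as many [g] as there are equivariant injections
    from (S, B) to (S, S'). *)
Lemma card_looptype (T : finType) (S : T -> T) (n : nat) (r : seq nat) :
  pairing S -> #|T| = n.*2 -> is_partition n r ->
  (#|[set S' : {ffun T -> T} | pairing S' && (looptype S S' == r)]| *
     (2 ^ size r * zee r))%N = #|commutant S|.
Proof.
move=> pS cT pr; have [B [pB tB]] := pairing_type_exists pS cT pr.
have /pairingP[BK Bn] := pB.
transitivity (\sum_(S' : {ffun T -> T} | pairing S' && (looptype S S' == r))
   \sum_(g : {ffun T -> T} | equivariant S B S S' g && injectiveb g) 1)%N.
  rewrite -sum_nat_const; apply: eq_big => [S'|S']; first by rewrite inE.
  rewrite inE => /andP[pS' /eqP tS']; rewrite sum1dep_card card_embeddings // tS'.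
  by rewrite loopcount_self // -tB perm_sym perm_looptype.
rewrite (exchange_big_dep (fun g : {ffun T -> T} => g \in commutant S)) /=; last first.
  move=> S' g _ /andP[/equivariantP[gS _] ig]; rewrite inE ig.
  by apply/forallP=> x; rewrite gS.
rewrite -sum1_card; apply: eq_bigr => g; rewrite inE => /andP[/injectiveP ig /forallP gS].
have [g' gK g'K] : bijective g by exact: inj_card_bij.
have {}gS x : g (S x) = S (g x) by apply/eqP.
pose S' := [ffun x => g (B (g' x))].
have pS' : pairing S'.
  apply/pairingP; split=> x; rewrite !ffunE; first by rewrite gK BK g'K.
  by rewrite -[X in _ != X]g'K (inj_eq ig) Bn.
have eg : equivariant S B S S' g by apply/equivariantP; split=> x; rewrite // ffunE gK.
rewrite (big_pred1 S') // => R; apply/idP/eqP=> [|->].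
  case/and3P=> _ /equivariantP[_ gB] _; apply/ffunP=> x.
  by rewrite ffunE gB g'K.
rewrite pS' eg /=; apply/andP; split; last by apply/injectiveP.
apply/eqP/sorted_perm_eq; rewrite -?tB; try exact: looptype_sorted.
rewrite -[X in perm_eq _ X]cats0; apply/(looptype_decomp (j := 0) pS pB pS pS' eg ig) => //.
  by rewrite addn0.
by move=> y /codomP[]; exists (g' y); rewrite g'K.
Qed.

(** * Partitions and dominance *)

Lemma partitions_uniq n : uniq (partitions n).
Proof. by rewrite filter_uniq ?undup_uniq. Qed.

Lemma size_le_sumn (s : seq nat) : all (fun x => 0 < x)%N s -> (size s <= sumn s)%N.
Proof. by elim: s => //= x s IH /andP[x0 /IH]; lia. Qed.

Lemma nth_le_sumn (s : seq nat) i : (nth 0 s i <= sumn s)%N.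
Proof. by elim: s i => [|x s IH] [|i] //=; [lia | have := IH i; lia]. Qed.

Lemma filter_nth_enum n r : is_partition n r ->
  [seq x <- [seq nth 0 r i | i : 'I_n <- enum 'I_n] | x != 0] = r.
Proof.
case/and3P=> _ r0 /eqP nr; have rn : (size r <= n)%N by rewrite -nr size_le_sumn.
rewrite (map_comp (nth 0 r) (@nat_of_ord n)) val_enum_ord.
have -> : iota 0 n = iota 0 (size r) ++ iota (size r) (n - size r).
  by rewrite -iotaD subnKC.
rewrite map_cat filter_cat map_nth_iota0 // take_size.
rewrite [X in _ ++ X](_ : _ = [::]) ?cats0.
  by apply/all_filterP/allP=> x /(allP r0); rewrite lt0n.
apply/eqP; rewrite -size_eq0 size_filter -leqn0 leqNgt -has_count.
apply/hasP=> -[x /mapP[i]]; rewrite mem_iota => /andP[ri _] ->.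
by rewrite nth_default.
Qed.

Lemma mem_partitions n r : (r \in partitions n) = is_partition n r.
Proof.
rewrite mem_filter mem_undup andb_idr // => /[dup] pr /and3P[sr r0 /eqP nr].
have lt i : (nth 0 r i < n.+1)%N by rewrite ltnS -nr nth_le_sumn.
apply/mapP; exists [ffun i : 'I_n => Ordinal (lt i)]; first by rewrite mem_enum.
rewrite /ptn_of (eq_map (g := fun i : 'I_n => nth 0 r i)); last by move=> i; rewrite ffunE.
by rewrite filter_nth_enum.
Qed.

Lemma eq_loopset (T : finType) (A B A' B' : T -> T) : A =1 A' -> B =1 B' ->
  loopset A B = loopset A' B'.
Proof.
move=> eA eB; apply: eq_imset => x; apply/setP=> y; rewrite !inE.
by apply: eq_connect => u v /=; rewrite eA eB.
Qed.

Lemma eq_looptype (T : finType) (A B A' B' : T -> T) : A =1 A' -> B =1 B' ->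
  looptype A B = looptype A' B'.
Proof. by move=> eA eB; rewrite /looptype (eq_loopset eA eB). Qed.

Lemma sum_ord_tail (G : nat -> nat) m N : m <= N ->
  (forall i, m <= i -> G i = 0) -> \sum_(i < N) G i = \sum_(i < m) G i.
Proof.
move=> mN G0; rewrite -!(big_mkord xpredT G) (big_cat_nat _ mN) //= [X in _ + X]big_nat_cond.
by rewrite [X in _ + X]big1 ?addn0 // => i /andP[/andP[/G0]].
Qed.

Lemma geq_sorted_nth (s : seq nat) i j : sorted geq s -> i <= j -> nth 0 s j <= nth 0 s i.
Proof.
move=> ss ij; case: (ltnP j (size s)) => js; last by rewrite nth_default.
have tr : transitive geq by move=> y x z xy yz; apply: leq_trans yz xy.
apply: (sorted_leq_nth tr _ 0 ss) => //; first by move=> x; exact: leqnn.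
by rewrite inE (leq_ltn_trans ij).
Qed.

Lemma nth_filter_pos (s : seq nat) i : sorted geq s ->
  nth 0 [seq x <- s | 0 < x] i = nth 0 s i.
Proof.
elim: s i => //= x s IH i ps; case: (posnP x) => [x0|x0].
  have z y : y \in s -> y = 0.
    move=> ys; have /allP/(_ y ys) : all (geq x) s.
      by apply: order_path_min ps => b a c ab bc; apply: leq_trans bc ab.
    by rewrite /= x0 leqn0 => /eqP.
  rewrite (_ : [seq _ <- _ | _] = [::]); last first.
    by apply/eqP; rewrite -size_eq0 size_filter -leqn0 leqNgt -has_count; apply/hasP=> -[y /z ->].
  rewrite nth_nil; case: i => [|i] /=; first by rewrite x0.
  case: (ltnP i (size s)) => si; last by rewrite nth_default.
  by rewrite (z (nth 0 s i)) ?mem_nth.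
by case: i => //= i; apply: IH; apply: path_sorted ps.
Qed.

Section TopSums.

Variables (n : nat) (e : 'I_n -> nat).

Notation es := (sort geq [seq e i | i <- enum 'I_n]).

Let es_sorted : sorted geq es.
Proof. by apply: sort_sorted => x y; apply: leq_total. Qed.

(** Let t be the entry of index j in the decreasing order. Both sums are compared with j t plus the
    total excess of the values over t, which bounds the left one and equals the right one. *)
Lemma top_sum_le (J : {set 'I_n}) (j : nat) : #|J| <= j ->
  \sum_(a in J) e a <= \sum_(i < j) nth 0 es i.
Proof.
move=> Jj; set t := nth 0 es j.
apply: (@leq_trans (j * t + \sum_a (e a - t))).
  apply: (@leq_trans (\sum_(a in J) (t + (e a - t)))).
    by apply: leq_sum => a _; lia.
  rewrite big_split sum_nat_const leq_add ?leq_mul2r ?Jj ?orbT //.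
  by rewrite big_mkcond /=; apply: leq_sum => a _; case: ifP.
have -> : \sum_a (e a - t) = \sum_(i < j) (nth 0 es i - t).
  rewrite -big_enum /= -[LHS](big_map e xpredT (fun x => x - t)).
  rewrite -(perm_big _ (permEl (perm_sort geq _))) /= (big_nth 0) big_mkord.
  rewrite -(@sum_ord_tail (fun i => nth 0 es i - t) (size es) (size es + j)) ?leq_addr //; last first.
    by move=> i si; rewrite nth_default.
  apply: (@sum_ord_tail (fun i => nth 0 es i - t)); rewrite ?leq_addl // => i ji.
  by apply/eqP; rewrite subn_eq0; apply: geq_sorted_nth.
have -> : j * t = \sum_(i < j) t by rewrite sum_nat_const card_ord.
rewrite -big_split /=; apply: eq_leq; apply: eq_bigr => i _.
by rewrite subnKC //; apply: geq_sorted_nth => //; apply: ltnW.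
Qed.

Lemma top_sum_attained (j : nat) : exists2 J : {set 'I_n}, #|J| <= j &
  \sum_(i < j) nth 0 es i = \sum_(a in J) e a.
Proof.
pose s := sort (relpre e geq) (enum 'I_n).
have us : uniq s by rewrite sort_uniq enum_uniq.
exists [set a in take j s].
  by rewrite cardsE (card_uniqP _) ?take_uniq // size_take; case: ltnP.
rewrite (eq_bigl (mem (take j s))); last by move=> a; rewrite inE.
rewrite -big_uniq ?take_uniq //= -(big_map e xpredT id) map_take -sort_map.
elim: j (es) => [|j IH] [|x u] /=; rewrite ?big_ord0 ?big_nil //.
  by rewrite big1 // => i _; rewrite nth_nil.
by rewrite big_ord_recl big_cons /= IH.
Qed.

End TopSums.

Lemma dominated_anti (mu la : seq nat) : sorted geq mu -> sorted geq la ->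
  all (fun x => 0 < x) mu -> all (fun x => 0 < x) la ->
  dominated mu la -> dominated la mu -> mu = la.
Proof.
move=> smu sla mu0 la0 /forallP d1 /forallP d2.
have E (i : nat) : i <= size mu + size la -> \sum_(k < i) nth 0 mu k = \sum_(k < i) nth 0 la k.
  rewrite -ltnS => lt; apply/eqP; rewrite eqn_leq (d1 (Ordinal lt)) /=.
  by rewrite addnC in lt; exact: (d2 (Ordinal lt)).
have N i : i < size mu + size la -> nth 0 mu i = nth 0 la i.
  move=> lt; have := E i.+1 lt; rewrite !big_ord_recr /= E; last exact: ltnW.
  by move/addnI.
have nth0 s i : all (fun x => 0 < x) s -> i < size s -> 0 < nth 0 s i.
  by move=> /allP s0 si; apply: s0; rewrite mem_nth.
have sz : size mu = size la.
  have Q s u : all (fun x => 0 < x) s ->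
      (forall i, i < size s + size u -> nth 0 s i = nth 0 u i) -> size s <= size u.
    move=> s0 H; rewrite leqNgt; apply/negP=> lt.
    by have := nth0 s _ s0 lt; rewrite H ?nth_default // ltn_addr.
  apply/eqP; rewrite eqn_leq !Q // => i; first by rewrite addnC => /N.
apply: (@eq_from_nth _ 0) => // i ilt; apply: N; exact: ltn_addr.
Qed.

Local Open Scope ring_scope.

(** * Power-sum expansions as sums over colourings *)

Definition coloring (T : finType) (n : nat) (e : 'X_{1..n}) (f : T -> 'I_n) : bool :=
  [forall j, #|[set x | f x == j]| == (e j).*2].

(** Expanding each power sum chooses a variable, that is a colour, for each loop. A loop of
    half-size s has 2s labels and contributes the exponent s, hence the doubling in [coloring]. *)
Lemma mcoeff_pprod (T : finType) (A B : T -> T) (n : nat) (e : 'X_{1..n}) :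
  pairing A -> pairing B ->
  (pprod n (looptype A B))@_e =
  #|[set f : {ffun T -> 'I_n} | loopconst A B f && coloring e f]|%:R.
Proof.
move=> pA pB.
have -> : pprod n (looptype A B) = \sum_(f : {ffun T -> 'I_n} | loopconst A B f)
    'X_[(\sum_(x | looprep A B x == x) U_(f x) *+ halfsize A B x)%MM].
  rewrite /pprod (perm_big _ (perm_looptype pA pB)) big_map big_filter big_enum_cond /=.
  rewrite /psum -(sum_loopconst (fun x j => 'X_j ^+ halfsize A B x)) //.
  apply: eq_bigr => f _; rewrite (big_morph _ (@mpolyXD _ _) (@mpolyX0 _ _)).
  by apply: eq_bigr => x _; rewrite mpolyXn.
rewrite raddf_sum /=.
under eq_bigr => f _ do rewrite mcoeffX.
rewrite -natr_sum -big_mkcondr; congr (_%:R); rewrite -sum1_card.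
apply: eq_big => // f; rewrite inE; case: (boolP (loopconst A B f)) => //= fc.
have key j : #|[set x | f x == j]| = ((\sum_(x | looprep A B x == x) U_(f x) *+ halfsize A B x)%MM j).*2.
  rewrite mnm_sumE -sum1_card big_mkcond (sum_loopreps pA pB).
  rewrite big_filter big_enum_cond /= -muln2 big_distrl /=; apply: eq_bigr => x _.
  rewrite (eq_bigr (fun=> (f x == j : nat))).
    by rewrite sum_nat_const card_loopofE // mulmnE mnmE; case: eqP; lia.
  move=> y yx; rewrite inE (_ : f y = f x); first by case: eqP.
  by move/loopconstP: fc => [fA fB]; apply: loopof_const fA fB _ _ yx.
apply/eqP/forallP=> [<- j|H]; first by rewrite key.
by apply/mnmP=> j; apply: double_inj; rewrite -key; apply/eqP.
Qed.

(* [zee r * 2 ^ size r] is, up to the constant [#|commutant S|], the inverse of the number of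
   pairings [S1] with [looptype S S1 = r] (see [card_looptype]); with this weight, sums over
   [S1] become sums over partitions. *)
Definition typeweight (d : seq nat -> rat) (r : seq nat) : rat :=
  d r * (zee r)%:R * 2 ^+ size r.

(** Only [S1] has to respect [f]. When [S] does too, this is the contribution of [f] to a
    coefficient of [pexp n d], up to [#|commutant S|]; orthogonality needs it for arbitrary [f]. *)
Definition fiberweight (T I : finType) (d : seq nat -> rat) (f : T -> I) (S : T -> T) : rat :=
  \sum_(S1 : {ffun T -> T} | pairing S1 && [forall x, f (S1 x) == f x])
     typeweight d (looptype S S1).

Lemma eq_fiberweight (T I : finType) (d : seq nat -> rat) (f f' : T -> I) (S S' : T -> T) :
  f =1 f' -> S =1 S' -> fiberweight d f S = fiberweight d f' S'.
Proof.
move=> ef eS; apply: eq_big => [S1|S1 _]; last by rewrite (eq_looptype eS (frefl S1)).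
by congr (_ && _); apply: eq_forallb => x; rewrite !ef.
Qed.

Lemma pairing_conj (T : finType) (A : T -> T) (h h' : T -> T) :
  pairing A -> cancel h h' -> cancel h' h -> pairing (fun x => h (A (h' x))).
Proof.
case/pairingP=> CK Cn hK h'K; apply/pairingP; split=> x; first by rewrite hK CK h'K.
by rewrite -[X in _ != X]h'K (inj_eq (can_inj hK)) Cn.
Qed.

Lemma looptype_conj (T : finType) (A B : T -> T) (h h' : T -> T) :
  pairing A -> pairing B -> cancel h h' -> cancel h' h ->
  looptype (fun x => h (A (h' x))) (fun x => h (B (h' x))) = looptype A B.
Proof.
move=> pA pB hK h'K.
have pC C : pairing C -> pairing (fun x => h (C (h' x))) by move=> /pairing_conj; apply.
apply: sorted_perm_eq; try exact: looptype_sorted.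
rewrite -[X in perm_eq _ X]cats0.
apply/(looptype_decomp (j := 0) pA pB (pC _ pA) (pC _ pB) (g := h)) => //.
- by apply/equivariantP; split=> x; rewrite ?hK.
- exact: can_inj hK.
- by rewrite addn0.
by move=> y /codomP[]; exists (h' y); rewrite h'K.
Qed.

Lemma eq_pairing (T : finType) (A A' : T -> T) : A =1 A' -> pairing A = pairing A'.
Proof. by move=> e; apply: eq_forallb => x; rewrite !e. Qed.

Lemma fiberweight_conj (T I : finType) (d : seq nat -> rat) (f : T -> I) (S h h' : T -> T) :
  pairing S -> cancel h h' -> cancel h' h ->
  fiberweight d (fun x => f (h x)) S = fiberweight d f (fun x => h (S (h' x))).
Proof.
move=> pS hK h'K; rewrite /fiberweight.
pose c (h h' : T -> T) (S1 : {ffun T -> T}) : {ffun T -> T} := [ffun x => h (S1 (h' x))].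
have cE h1 h2 S1 : c h1 h2 S1 =1 fun x => h1 (S1 (h2 x)) by move=> x; rewrite ffunE.
rewrite (reindex_onto (c h' h) (c h h')); last by move=> S1 _; apply/ffunP=> x; rewrite !ffunE !hK.
apply: eq_big => [S1|S1 /andP[/andP[pS1 _] _]].
  rewrite [X in _ && X](_ : _ = true) ?andbT; last by apply/eqP/ffunP=> x; rewrite !ffunE !h'K.
  rewrite (eq_pairing (cE h' h S1)); congr (_ && _).
    apply/idP/idP=> [/pairing_conj/(_ hK h'K)|/pairing_conj/(_ h'K hK) //].
    by rewrite (eq_pairing (A' := S1)) // => x; rewrite !h'K.
  apply/forallP/forallP=> H x; last by rewrite ffunE !h'K.
  by have := H (h' x); rewrite ffunE !h'K.
rewrite -(looptype_conj pS pS1 hK h'K); congr typeweight; apply: eq_looptype => // x.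
by rewrite ffunE !h'K.
Qed.


Lemma big_by_value (I : finType) (K : eqType) (ks : seq K) (P : pred I) (key : I -> K)
    (F : I -> rat) : uniq ks -> (forall i, P i -> key i \in ks) ->
  \sum_(i | P i) F i = \sum_(k <- ks) \sum_(i | P i && (key i == k)) F i.
Proof.
move=> uks Pks; rewrite (exchange_big_dep P) /=; last by move=> k i _ /andP[].
apply: eq_bigr => i Pi; rewrite (eq_bigl (fun k => k == key i)) => [|k]; last by rewrite Pi eq_sym.
rewrite big_mkcond (bigD1_seq (key i)) ?Pks //= eqxx big1 ?addr0 // => k.
by move=> /negbTE ->.
Qed.

Lemma sum_by_looptype (T : finType) (S : T -> T) (n : nat) (F : seq nat -> rat) :
  pairing S -> #|T| = n.*2 ->
  \sum_(S1 : {ffun T -> T} | pairing S1) typeweight F (looptype S S1) =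
  #|commutant S|%:R * \sum_(r <- partitions n) F r.
Proof.
move=> pS cT.
rewrite (big_by_value (key := fun S1 : {ffun T -> T} => looptype S S1) _ (partitions_uniq n));
  last by move=> S1 pS1; rewrite mem_partitions looptype_partition.
rewrite big_distrr /= big_seq [RHS]big_seq; apply: eq_bigr => r.
rewrite mem_partitions => pr; rewrite -(card_looptype pS cT pr).
rewrite (eq_bigr (fun=> typeweight F r)); last by move=> S1 /andP[_ /eqP->].
rewrite sumr_const /typeweight -cardsE natrM natrM natrX -mulr_natl; ring.
Qed.

Lemma mcoeff_pexp (T : finType) (S : T -> T) (n : nat) (d : seq nat -> rat) (e : 'X_{1..n}) :
  pairing S -> #|T| = n.*2 ->
  #|commutant S|%:R * (pexp n d)@_e =
  \sum_(f : {ffun T -> 'I_n} | [forall x, f (S x) == f x] && coloring e f) fiberweight d f S.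
Proof.
move=> pS cT; rewrite /pexp raddf_sum /=.
under eq_bigr => r _ do rewrite mcoeffZ.
rewrite -(sum_by_looptype _ pS cT) /fiberweight.
rewrite [RHS](exchange_big_dep (fun S1 : {ffun T -> T} => pairing S1)) /=; last by move=> f S1 _ /andP[].
apply: eq_bigr => S1 pS1; rewrite /typeweight mcoeff_pprod //.
have move_coef (a b c m : rat) : a * m * b * c = m * (a * b * c) by ring.
rewrite sumr_const -[RHS]mulr_natl move_coef.
congr (_%:R * _); apply: eq_card => f.
rewrite !inE unfold_in pS1 /= [RHS]andbAC.
congr (_ && _); apply/esym; apply/andP/loopconstP => [[/forallP H1 /forallP H2]|[H1 H2]].
  by split=> x; apply/eqP.
by split; apply/forallP=> x; apply/eqP.
Qed.

(** * Vanishing of weights for dominating colourings *)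

Definition fiber (T I : finType) (f : T -> I) (a : I) : nat := #|[set x | f x == a]|.

Definition recolor (T I : finType) (f : T -> I) (i : T) (a : I) (x : T) : I :=
  if x == i then a else f x.

(** The class sizes of [f] dominate the doubled parts of [la]. Stated with a witness set of colours
    instead of sorted sizes, the property is easy to follow through a recolouring. *)
Definition heavy (T : finType) (n : nat) (la : seq nat) (f : T -> 'I_n) : Prop :=
  forall j, exists2 J : {set 'I_n}, (#|J| <= j)%N &
    ((\sum_(i < j) nth 0 la i).*2 <= \sum_(a in J) fiber f a)%N.

Definition strictly_below (n : nat) (la : seq nat) (d : seq nat -> rat) : Prop :=
  forall e : 'X_{1..n}, (pexp n d)@_e != 0 -> dominated (mshape e) la && (mshape e != la).

Lemma mshape_sorted n (e : 'X_{1..n}) : sorted geq (mshape e).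
Proof.
rewrite sorted_filter //; first by move=> y x z xy yz; apply: leq_trans yz xy.
by apply: sort_sorted => x y; apply: leq_total.
Qed.

Lemma mshape_pos n (e : 'X_{1..n}) : all (fun x => 0 < x)%N (mshape e).
Proof. exact: filter_all. Qed.

Lemma nth_mshape n (e : 'X_{1..n}) i :
  nth 0%N (mshape e) i = nth 0%N (sort geq [seq e i | i <- enum 'I_n]) i.
Proof.
by rewrite nth_filter_pos //; apply: sort_sorted => x y; apply: leq_total.
Qed.

(** The halved class sizes form an exponent whose shape dominates [la]. A nonzero coefficient there
    would force the shape to be [la] by antisymmetry, which [strictly_below] excludes. *)
Lemma fiberweight_compatible (T : finType) (n : nat) (la : seq nat) (d : seq nat -> rat)
    (S : T -> T) (f : T -> 'I_n) :
  pairing S -> #|T| = n.*2 -> sorted geq la -> all (fun x => 0 < x)%N la ->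
  strictly_below n la d -> heavy la f -> (forall x, f (S x) = f x) ->
  fiberweight d f S = 0.
Proof.
move=> pS cT sla la0 db hf fS.
pose e := [multinom (fiber f a)./2 | a < n].
have ce : coloring e f.
  by apply/forallP=> a; rewrite mnmE /fiber (card_pairlower a pS fS) doubleK.
have ed : dominated la (mshape e).
  apply/forallP=> j; have [J Jj HJ] := hf j.
  under [X in (_ <= X)%N]eq_bigr => i _ do rewrite nth_mshape.
  apply: leq_trans (top_sum_le e Jj).
  rewrite -leq_double; apply: (leq_trans HJ); rewrite -!muln2 big_distrl /=.
  by apply: leq_sum => a _; move/forallP: ce => /(_ a) /eqP; rewrite /fiber muln2 => ->.
have z : (pexp n d)@_e = 0.
  apply: contraTeq isT => /db /andP[de /eqP[]].
  exact: (dominated_anti (mshape_sorted e) sla (mshape_pos e) la0).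
have := mcoeff_pexp d e pS cT; rewrite z mulr0 => /esym.
(* The colourings counted by this coefficient are conjugate to [f] by permutations commuting with
   [S], so they have equal weights; [f] is one of them, so their number is nonzero. *)
rewrite (eq_bigr (fun=> fiberweight d f S)).
  rewrite sumr_const => /eqP; rewrite mulrn_eq0 => /orP[/eqP c0|/eqP //].
  have := card0_eq c0 [ffun x => f x]; rewrite !inE /= => /negP[].
  apply/andP; split; first by apply/forallP=> x; rewrite !ffunE fS.
  apply/forallP=> a; move/forallP: ce => /(_ a) /eqP <-; apply/eqP.
  by apply: eq_card => x; rewrite !inE ffunE.
move=> f' /andP[/forallP f'S cf'].
have {}f'S x : f' (S x) = f' x by apply/eqP.
have [|h [ih hS hf']] := pairing_transport pS pS f'S fS.
  by move=> a; move/forallP: ce => /(_ a)/eqP->; apply/eqP; move/forallP: cf'; apply.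
have [h' hK h'K] : bijective h by exact: inj_card_bij.
rewrite (eq_fiberweight d (fsym hf') (frefl S)) (fiberweight_conj d f pS hK h'K).
by apply: eq_fiberweight => // x; rewrite hS h'K.
Qed.

Lemma recolor_pair (T I : finType) (f : T -> I) (S : T -> T) (a b : I) (i : T) :
  pairing S -> f i = b -> [forall x, recolor f i a (S x) == recolor f i a x] ->
  f (S i) = a /\ [forall x, recolor f (S i) b (S x) == recolor f (S i) b x].
Proof.
case/pairingP=> SK Sn fi /forallP H.
have fSi : f (S i) = a.
  by have := H i; rewrite /recolor eqxx (negbTE (Sn i)) => /eqP.
split=> //; apply/forallP=> x; rewrite /recolor.
have := H x; rewrite /recolor (can_eq SK).
have -> : (S x == i) = (x == S i) by rewrite -(can_eq SK) SK.
case: (eqVneq x i) => [-> | xi]; first by rewrite [i == S i]eq_sym (negbTE (Sn i)) fi eqxx.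
by case: (eqVneq x (S i)) => [->|_] //; rewrite SK fi.
Qed.

(** For each fixed [S1] the substitution of [S1 i] for [i] exchanges the two sides. *)
Lemma fiberweight_rotate (T I : finType) (d : seq nat -> rat) (f : T -> I) (S : T -> T) (a b : I) :
  \sum_(i | f i == b) fiberweight d (recolor f i a) S =
  \sum_(j | f j == a) fiberweight d (recolor f j b) S.
Proof.
rewrite /fiberweight.
rewrite (exchange_big_dep (fun S1 : {ffun T -> T} => pairing S1)) /=; last by move=> i S1 _ /andP[].
rewrite [RHS](exchange_big_dep (fun S1 : {ffun T -> T} => pairing S1)) /=; last by move=> i S1 _ /andP[].
apply: eq_bigr => S1 pS1; have /pairingP[SK _] := pS1.
rewrite (reindex_inj (can_inj SK)) /=; apply: eq_bigl => j; rewrite pS1 /=.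
apply/andP/andP=> -[/eqP fj H].
  by have := recolor_pair pS1 fj H; rewrite SK => -[-> H']; rewrite eqxx.
by have [-> H'] := recolor_pair pS1 fj H; rewrite eqxx.
Qed.

Lemma fiber_recolor (T I : finType) (f : T -> I) (i : T) (a b c : I) : f i = b -> a != b ->
  (fiber (recolor f i a) c + (c == b) = fiber f c + (c == a))%N.
Proof.
move=> fi ab; rewrite /fiber.
have E (g : T -> I) : #|[set x | g x == c]| = ((g i == c) + #|[set x | (g x == c) && (x != i)]|)%N.
  rewrite (cardsD1 i) inE; congr (_ + _)%N; apply: eq_card => x; by rewrite !inE andbC.
rewrite (E f) (E (recolor f i a)) fi /recolor eqxx ![_ == c]eq_sym.
rewrite (_ : [set x | ((if x == i then a else f x) == c) && (x != i)] = [set x | (f x == c) && (x != i)]).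
  by lia.
by apply/setP=> x; rewrite !inE; case: (eqVneq x i) => //=; rewrite !andbF.
Qed.

Lemma sum_fiber (T I : finType) (f : T -> I) : (\sum_a fiber f a)%N = #|T|.
Proof.
rewrite -[RHS]sum1_card (partition_big f xpredT) //=; apply: eq_bigr => a _.
by rewrite sum1_card /fiber cardsE; apply: eq_card => x.
Qed.

Definition mixed (T I : finType) (f : T -> I) (S : T -> T) : {set T} :=
  [set x | f (S x) != f x].

Lemma fiberweight_perm (T I : finType) (d : seq nat -> rat) (f : T -> I) (S : T -> T)
    (h : {perm T}) : pairing S -> (forall z, h (S z) = S (h z)) ->
  fiberweight d (fun x => f (h x)) S = fiberweight d f S.
Proof.
move=> pS hS; rewrite (fiberweight_conj d f pS (permK h) (permKV h)).
by apply: eq_fiberweight => // x; rewrite hS permKV.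
Qed.

Lemma tperm_pair_comm (T : finType) (S : T -> T) (x z : T) : pairing S ->
  tperm x (S x) (S z) = S (tperm x (S x) z).
Proof.
case/pairingP=> SK Sn.
case: (eqVneq z x) => [->|zx]; first by rewrite tpermL tpermR SK.
case: (eqVneq z (S x)) => [->|zSx]; first by rewrite SK tpermL tpermR.
rewrite !tpermD // eq_sym ?(can_eq SK) //.
by rewrite -(can_eq SK) SK.
Qed.

Lemma tperm_pairs_comm (T : finType) (S : T -> T) (x y z : T) : pairing S ->
  x != y -> y != S x ->
  (tperm x y * tperm (S x) (S y))%g (S z) = S ((tperm x y * tperm (S x) (S y))%g z).
Proof.
case/pairingP=> SK Sn xy ySx; rewrite !permM.
have yx : y != x by rewrite eq_sym.
have Sxy : S x != y by rewrite eq_sym.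
have Syx : S y != x by rewrite -(can_eq SK) SK.
have xSy : x != S y by rewrite eq_sym.
have xSx : x != S x by rewrite eq_sym.
have ySy : y != S y by rewrite eq_sym.
have SxSy : S x != S y by rewrite (can_eq SK).
have D1 : tperm x y (S x) = S x by rewrite tpermD.
have D2 : tperm x y (S y) = S y by rewrite tpermD.
have D3 : tperm (S x) (S y) x = x by rewrite tpermD.
have D4 : tperm (S x) (S y) y = y by rewrite tpermD.
case: (eqVneq z x) => [->|zx]; first by rewrite D1 !tpermL D4.
case: (eqVneq z y) => [->|zy]; first by rewrite D2 !tpermR D3.
case: (eqVneq z (S x)) => [->|zSx]; first by rewrite D1 !SK !tpermL D4 SK.
case: (eqVneq z (S y)) => [->|zSy]; first by rewrite D2 !SK !tpermR D3 SK.
have T1 : tperm x y z = z by rewrite tpermD // eq_sym.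
have T2 : tperm (S x) (S y) z = z by rewrite tpermD // eq_sym.
have T3 : tperm x y (S z) = S z by rewrite tpermD // -(can_eq SK) SK eq_sym.
by rewrite T1 T2 T3 tpermD // (can_eq SK) eq_sym.
Qed.

Lemma heavy_fiber (T : finType) (n : nat) (la : seq nat) (f g : T -> 'I_n) :
  fiber f =1 fiber g -> heavy la f -> heavy la g.
Proof.
by move=> fg hf j; have [J Jj H] := hf j; exists J => //; under eq_bigr => a _ do rewrite -fg.
Qed.

(* Moving two boxes from a smaller colour class to a larger one can only increase the top sums. *)
Lemma heavy_move (T : finType) (n : nat) (la : seq nat) (f g : T -> 'I_n) (a b : 'I_n) :
  a != b -> (fiber f a <= fiber f b)%N -> (fiber g b = fiber f b + 2)%N ->
  (fiber g a + 2 = fiber f a)%N ->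
  (forall c, c != a -> c != b -> fiber g c = fiber f c) ->
  heavy la f -> heavy la g.
Proof.
move=> ab le gb ga gc hf j; have [J Jj H] := hf j.
case: (boolP (a \in J)) => aJ; last first.
  exists J => //; apply: (leq_trans H); apply: leq_sum => c cJ.
  case: (eqVneq c b) => [->|cb]; first by rewrite gb leq_addr.
  by rewrite gc //; apply: contraNneq aJ => <-.
case: (boolP (b \in J)) => bJ.
  exists J => //; apply: (leq_trans H).
  rewrite (bigD1 a) //= [X in (_ <= X)%N](bigD1 a) //= (bigD1 b) /=; last by rewrite bJ eq_sym.
  rewrite [X in (_ <= _ + X)%N](bigD1 b) /=; last by rewrite bJ eq_sym.
  rewrite (eq_bigr (fiber g)); first by rewrite gb -ga !addnA leq_add2r -!addnA [(2 + _)%N]addnC.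
  by move=> c /andP[/andP[_ ca] cb]; rewrite gc.
exists (b |: J :\ a).
  by apply: leq_trans Jj; rewrite cardsU1 [X in (_ <= X)%N](cardsD1 a) aJ leq_add2r leq_b1.
apply: (leq_trans H); rewrite (bigD1 a) //= [X in (_ <= X)%N](bigD1 b) /=; last by rewrite !inE eqxx.
apply: leq_add; first by rewrite gb (leq_trans le) ?leq_addr.
rewrite leq_eqVlt; apply/orP; left; apply/eqP; apply: eq_big => [c|c /andP[cJ ca]].
  rewrite !inE; case: (eqVneq c b) => [->|] /=; first by rewrite (negbTE bJ).
  by rewrite andbT andbC.
by rewrite gc //; apply: contraNneq bJ => <-.
Qed.

Definition squares (T I : finType) (f : T -> I) : nat := (\sum_a fiber f a ^ 2)%N.

Lemma squares_le (T I : finType) (f : T -> I) : (squares f <= #|T| ^ 2)%N.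
Proof.
rewrite -mulnn -{1}(sum_fiber f) big_distrl /=; apply: leq_sum => a _.
by rewrite -mulnn leq_mul2l /fiber max_card orbT.
Qed.

Lemma squares_move (T I : finType) (f g : T -> I) (a b : I) :
  a != b -> (fiber f a <= fiber f b)%N -> (fiber g b = fiber f b + 2)%N ->
  (fiber g a + 2 = fiber f a)%N ->
  (forall c, c != a -> c != b -> fiber g c = fiber f c) ->
  (squares f < squares g)%N.
Proof.
move=> ab le gb ga gc; rewrite /squares (bigD1 a) //= (bigD1 b) 1?eq_sym //=.
rewrite [X in (_ < X)%N](bigD1 a) //= [X in (_ < _ + X)%N](bigD1 b) 1?eq_sym //=.
rewrite (eq_bigr (fun c => fiber g c ^ 2)%N).
  rewrite !addnA ltn_add2r gb; move: le; rewrite -ga.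
  by move: (fiber g a) (fiber f b) => x y; nia.
by move=> c /andP[ca cb]; rewrite gc.
Qed.

(** Lexicographic induction: the sum of squares of the class sizes, which is bounded, increases, or
    it stays the same and fewer labels are mixed. The base case is a colouring compatible with
    [S]. *)
Lemma fiberweight_vanish (T : finType) (n : nat) (la : seq nat) (d : seq nat -> rat) :
  #|T| = n.*2 -> sorted geq la -> all (fun x => 0 < x)%N la ->
  strictly_below n la d ->
  forall (S : T -> T) (f : T -> 'I_n), pairing S -> heavy la f -> fiberweight d f S = 0.
Proof.
move=> cT sla la0 db S f pS; have /pairingP[SK Sn] := pS.
have [m] := ubnP (#|T| ^ 2 - squares f); elim: m f => // m IHm f.
have [l] := ubnP #|mixed f S|; elim: l f => // l IHl f; rewrite !ltnS => ml sm hf.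
have [u|fS] := pickP (mem (mixed f S)); last first.
  apply: (fiberweight_compatible pS cT sla la0 db hf) => x.
  by apply/eqP; have := fS x; rewrite !inE => /negbFE.
rewrite /= inE => fSu.
wlog le : u fSu / (fiber f (f u) <= fiber f (f (S u)))%N => [H|].
  case: (leqP (fiber f (f u)) (fiber f (f (S u)))) => [|/ltnW] le; first exact: (H u).
  by apply: (H (S u)); rewrite SK // eq_sym.
set a := f u in fSu le; set b := f (S u) in fSu le.
have ab : a != b by rewrite eq_sym.
(* One label of the pair of [u] is given the colour of its partner; undoing this at an arbitrary
   label of colour [b] is the left side of the exchange identity, and its term at [u] is the wanted
   weight. *)
pose f0 := recolor f u b.
have f0u : f0 u = b by rewrite /f0 /recolor eqxx.
have f0n x : x != u -> f0 x = f x by rewrite /f0 /recolor => /negbTE ->.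
have fib0 c : (fiber f0 c + (c == a) = fiber f c + (c == b))%N.
  by apply: fiber_recolor; rewrite // eq_sym.
have := fiberweight_rotate d f0 S a b.
(* A term on the right has moved two labels from class [a] to class [b], which was at least as
   large: the sum of squares has grown. *)
rewrite [RHS]big1; last first.
  move=> j /eqP f0j.
  have fib1 c : (fiber (recolor f0 j b) c + (c == a) = fiber f0 c + (c == b))%N.
    by apply: fiber_recolor; rewrite // eq_sym.
  have E1 : (fiber (recolor f0 j b) b = fiber f b + 2)%N.
    by have := fib1 b; have := fib0 b; rewrite eqxx eq_sym (negbTE ab); lia.
  have E2 : (fiber (recolor f0 j b) a + 2 = fiber f a)%N.
    by have := fib1 a; have := fib0 a; rewrite eqxx (negbTE ab); lia.
  have E3 c : c != a -> c != b -> fiber (recolor f0 j b) c = fiber f c.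
    by move=> /negbTE ca /negbTE cb; have := fib1 c; have := fib0 c; rewrite ca cb; lia.
  apply: IHm; last exact: (heavy_move ab le E1 E2 E3).
  by have := squares_move ab le E1 E2 E3; have := squares_le (recolor f0 j b); lia.
(* The other terms exchange the colours of [u] and [i], which mends the pair of [u]. Unless [i] is
   good, no new mixed pair arises and the induction on mixed labels applies. *)
pose good i := [|| i == u, i == S u | f (S i) == b].
rewrite (bigID good) /= [X in _ + X]big1 ?addr0; last first.
  move=> i /andP[/eqP f0i]; rewrite /good !negb_or => /and3P[iu iSu fSi].
  have fi : f i = b by rewrite -f0n.
  have fib1 c : fiber (recolor f0 i a) c = fiber f c.
    by apply: (@addIn (c == b)); rewrite (fiber_recolor c f0i ab) fib0.
  apply: IHl; last by apply: heavy_fiber hf => c; rewrite fib1.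
    apply: leq_trans ml; apply/proper_card/properP; split.
      apply/subsetP=> x; rewrite !inE; apply: contraNneq => fSx.
      rewrite /recolor /f0 /recolor.
      case: (eqVneq x i) => [xi|xi].
        by rewrite -fi -xi -fSx xi eqxx in fSi.
      case: (eqVneq x u) => [xu|xu].
        by rewrite /a /b -xu fSx eqxx in ab.
      case: (eqVneq (S x) i) => [E|_].
        by rewrite -E SK -fSx E fi eqxx in fSi.
      case: (eqVneq (S x) u) => [E|_]; last by rewrite fSx.
      by rewrite /a /b -E SK fSx eqxx in ab.
    exists u; first by rewrite inE.
    by rewrite inE negbK /recolor ![_ == i]eq_sym (negbTE iu) (negbTE iSu) f0u f0n ?Sn.
  by rewrite /squares; under eq_bigr => c _ do rewrite fib1.
(* Each good term is conjugate to [f] by a permutation commuting with [S]: the identity, the swap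
   inside the pair of [u], or the swap of the pairs of [u] and [i]. Since [u] is good, a positive
   multiple of the weight of [f] vanishes. *)
rewrite (eq_bigr (fun=> fiberweight d f S)).
  rewrite sumr_const => /eqP; rewrite mulrn_eq0 => /orP[/eqP c0|/eqP //].
  by have := card0_eq c0 u; rewrite unfold_in /= f0u /good !eqxx.
move=> i /andP[/eqP f0i gi]; have uSu : u != S u by rewrite eq_sym.
case: (eqVneq i u) gi f0i => [-> _ _ | iu].
  by apply: eq_fiberweight => // x; rewrite /recolor; case: eqVneq => [->|/f0n].
case: (eqVneq i (S u)) => [-> _ _ | iSu].
  rewrite -(fiberweight_perm d f (h := tperm u (S u)) pS); last by move=> z; exact: tperm_pair_comm.
  apply: eq_fiberweight => // x; rewrite /recolor.
  case: (eqVneq x (S u)) => [->|xSu]; first by rewrite tpermR.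
  case: (eqVneq x u) => [->|xu]. by rewrite tpermL f0u.
  by rewrite tpermD 1?eq_sym // f0n.
rewrite /good (negbTE iu) (negbTE iSu) /= => /eqP fSi; rewrite f0n // => fi.
have ui : u != i by rewrite eq_sym.
rewrite -(fiberweight_perm d f (h := (tperm u i * tperm (S u) (S i))%g) pS); last first.
  by move=> z; apply: tperm_pairs_comm.
have Siu : S i != u by rewrite -(can_eq SK) SK.
apply: eq_fiberweight => // x; rewrite permM /recolor.
case: (eqVneq x i) => [->|xi].
  by rewrite tpermR tpermD.
case: (eqVneq x u) => [->|xu]; first by rewrite tpermL f0u tpermD // eq_sym.
rewrite f0n // (tpermD (x := u) (y := i)) 1?eq_sym //.
case: (eqVneq x (S u)) => [->|xSu]; first by rewrite tpermL fSi.
case: (eqVneq x (S i)) => [->|xSi]; first by rewrite tpermR fSi.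
by rewrite tpermD 1?eq_sym.
Qed.

(** * The zonal coefficients *)

(** A column of [la] becomes two columns of the doubled diagram, and [B] matches one with the other.
    Hence [dside] alternates along the loops of [domino] and [B]. *)
Definition colpairing (la : seq nat) (B : diagram la -> diagram la) : bool :=
  pairing B && [forall x, (dcol (B x) == dcol x) && (dside (B x) == ~~ dside x)].

Definition rowpairing (la : seq nat) (A : diagram la -> diagram la) : bool :=
  pairing A && [forall x, drow (A x) == drow x].

(** The shift by [sumn la] gives [domino] itself the sign 1. *)
Definition colsign (la : seq nat) (B : diagram la -> diagram la) : rat :=
  (-1) ^+ (sumn la + #|loopset (@domino la) B|).

Definition zonal (la : seq nat) (r : seq nat) : rat :=
  \sum_(B : {ffun diagram la -> diagram la} | colpairing B)
  \sum_(A : {ffun diagram la -> diagram la} | rowpairing A && (looptype B A == r))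
    colsign B.

Lemma sum_zonal (la : seq nat) (F : seq nat -> rat) :
  \sum_(r <- partitions (sumn la)) zonal la r * F r =
  \sum_(B : {ffun diagram la -> diagram la} | colpairing B)
  \sum_(A : {ffun diagram la -> diagram la} | rowpairing A)
     colsign B * F (looptype B A).
Proof.
under eq_bigr => r _ do rewrite mulr_suml.
rewrite exchange_big; apply: eq_bigr => B /andP[pB _].
rewrite (big_by_value (key := fun A : {ffun diagram la -> diagram la} => looptype B A) _
   (partitions_uniq (sumn la))); last first.
  by move=> A /andP[pA _]; rewrite mem_partitions looptype_partition // card_diagram.
apply: eq_bigr => r _; rewrite mulr_suml; apply: eq_bigr => A /andP[_ /eqP ->].
by [].
Qed.

Lemma sum_ltn m i : (\sum_(k < m) (k < i) = minn m i)%N.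
Proof.
elim: m => [|m IH]; first by rewrite big_ord0 min0n.
by rewrite big_ord_recr IH /=; case: ltnP; lia.
Qed.

(** The first [j] rows are a witness, with equality. Rows are embedded among [sumn la] colours
    because that is the number of variables of [pexp]. *)
Lemma heavy_drow (la : seq nat) (le : (size la <= sumn la)%N) :
  heavy la (fun x : diagram la => widen_ord le (drow x)).
Proof.
move=> j; exists [set a : 'I_(sumn la) | (a < j)%N].
  rewrite -sum1_card big_mkcond /=.
  rewrite (eq_bigr (fun a : 'I_(sumn la) => (a < j)%N : nat)).
    by rewrite sum_ltn geq_minr.
  by move=> a _; rewrite inE; case: ltnP.
have fE (a : 'I_(sumn la)) :
    fiber (fun x : diagram la => widen_ord le (drow x)) a = (nth 0 la a).*2.
  case: (ltnP a (size la)) => al.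
    rewrite -(card_drow (Ordinal al)); apply: eq_card => x.
    by rewrite !inE -!val_eqE.
  rewrite nth_default //; apply: eq_card0 => x; rewrite inE -val_eqE /=.
  by apply/negP=> /eqP E; have := ltn_ord (drow x); rewrite E ltnNge al.
under [X in (_ <= X)%N]eq_bigr => a _ do rewrite fE.
rewrite -muln2 big_distrl /=.
case: (leqP j (sumn la)) => [jn|/ltnW nj].
  rewrite (big_ord_widen _ (fun i => nth 0 la i * 2)%N jn).
  rewrite (eq_bigl (fun a : 'I_(sumn la) => (a < j)%N)); last by move=> a; rewrite inE.
  by apply: eq_leq; apply: eq_bigr => a _; rewrite muln2.
rewrite (@sum_ord_tail (fun i => nth 0 la i * 2)%N _ _ nj); last first.
  by move=> i ni; rewrite nth_default // (leq_trans le).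
rewrite [X in (_ <= X)%N](eq_bigl xpredT); last first.
  by move=> a; rewrite inE (leq_trans (ltn_ord a)).
by apply: eq_leq; apply: eq_bigr => a _; rewrite muln2.
Qed.

Lemma sign_flip (a b c : nat) : odd b = ~~ odd c -> (-1) ^+ (a + b) = - (-1) ^+ (a + c) :> rat.
Proof.
move=> bc; rewrite -signr_odd -[in RHS]signr_odd !oddD bc.
by case: (odd a); case: (odd c); rewrite /= ?expr0 ?expr1 ?opprK.
Qed.

Lemma colsign_swap (la : seq nat) (B : diagram la -> diagram la) (x y : diagram la) :
  colpairing B -> dside x = dside y -> x != y ->
  colsign (swapconj x y B) = - colsign B.
Proof.
case/andP=> pB /forallP cB sxy xy; apply: sign_flip.
rewrite !(loopset_sym (@domino la)).
apply: (odd_loopset_swapconj (chi := @dside la)) => //; first exact: pairing_domino.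
- by move=> z; case/andP: (cB z) => _ /eqP.
- by move=> z; rewrite dside_domino.
Qed.

Lemma eq_colsign (la : seq nat) (B B' : diagram la -> diagram la) : B =1 B' ->
  colsign B = colsign B'.
Proof. by move=> eB; rewrite /colsign (eq_loopset (frefl _) eB). Qed.

Lemma colsum_cancel (la : seq nat) (I : finType) (f : diagram la -> I) (x y : diagram la) :
  dcol x = dcol y -> dside x = dside y -> f x = f y -> x != y ->
  \sum_(B : {ffun diagram la -> diagram la} | colpairing B && [forall z, f (B z) == f z]) colsign B = 0.
Proof.
move=> cxy sxy fxy xy.
pose c (B : {ffun diagram la -> diagram la}) : {ffun diagram la -> diagram la} :=
  [ffun z => swapconj x y B z].
have cE B : c B =1 swapconj x y B by move=> z; rewrite ffunE.
have cK : involutive c.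
  by move=> B; apply/ffunP=> z; rewrite ffunE /swapconj cE /swapconj !tpermK.
have inv (V : Type) (k : diagram la -> V) z : k x = k y -> k (tperm x y z) = k z.
  by move=> kxy; case: tpermP => [->|->|].
have cc (B : {ffun diagram la -> diagram la}) : colpairing B && [forall z, f (B z) == f z] ->
    colpairing (c B) && [forall z, f (c B z) == f z].
  case/andP=> /andP[pB /forallP cB] /forallP fB; rewrite /colpairing (eq_pairing (cE B)).
  rewrite pairing_swapconj //=; apply/andP; split; apply/forallP=> z; rewrite cE /swapconj.
    rewrite (inv _ (@dcol la)) // (inv _ (@dside la)) //.
    by case/andP: (cB (tperm x y z)) => /eqP-> /eqP->;
      rewrite (inv _ (@dcol la)) // (inv _ (@dside la)) ?eqxx.
  by rewrite (inv _ f) // (eqP (fB _)) (inv _ f).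
set s := \sum_(B | _) _.
have sN : s = - s.
  rewrite {1}/s (reindex_inj (can_inj cK)) /= -sumrN; apply: eq_big => [B|B H].
    by apply/idP/idP=> /cc //; rewrite cK.
  have H' : colpairing B by have := cc _ H; rewrite cK => /andP[].
  by rewrite -(colsign_swap H' sxy xy); apply: eq_colsign.
have : s *+ 2 = 0 by rewrite mulr2n {2}sN subrr.
by move/eqP; rewrite mulrn_eq0 => /eqP.
Qed.

Lemma sum_partial_cols (la : seq nat) (j M : nat) : all (fun x => x <= M)%N la ->
  (\sum_(i < j) nth 0 la i = \sum_(c < M) \sum_(i < j) (c < nth 0 la i))%N.
Proof.
move=> /allP laM; rewrite exchange_big /=; apply: eq_bigr => i _.
have iM : (nth 0 la i <= M)%N.
  by case: (ltnP i (size la)) => il; [apply: laM; rewrite mem_nth | rewrite nth_default].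
rewrite -[LHS]card_ord -sum1_card (big_ord_widen M (fun=> 1%N) iM) big_mkcond /=.
by apply: eq_bigr => c _; case: ltnP.
Qed.

(** Column [c] occupies an initial segment of the rows, so its part in the first [j] rows has the
    minimum of [j] and its height as size. *)
Lemma column_bound (la : seq nat) (c j N : nat) : sorted geq la -> (N <= j)%N ->
  (N <= \sum_(i < size la) (c < nth 0 la i))%N -> (N <= \sum_(i < j) (c < nth 0%N la i))%N.
Proof.
move=> sla Nj Nl.
have all_lt i : (i < N)%N -> (c < nth 0 la i)%N.
  move=> iN; rewrite ltnNge; apply/negP=> le.
  have : (\sum_(k < size la) (c < nth 0 la k) <= i)%N; last by lia.
  rewrite (@leq_trans (\sum_(k < size la) (k < i))%N) //; last by rewrite sum_ltn geq_minr.
  apply: leq_sum => k _; case: (ltnP k i) => [|ik]; first by case: (c < _)%N.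
  by rewrite ltnNge (leq_trans (geq_sorted_nth sla ik) le).
rewrite -{1}[N]muln1 -{1}(card_ord N) -sum_nat_const.
rewrite (big_ord_widen j (fun=> 1%N) Nj) big_mkcond /=; apply: leq_sum => k _.
by case: ifP => // /all_lt ->.
Qed.

Lemma sum_fiber_in (T I : finType) (f : T -> I) (J : {set I}) :
  (\sum_(a in J) fiber f a)%N = #|[set x | f x \in J]|.
Proof.
rewrite -[RHS]sum1_card (partition_big f (mem J)) /=; last by move=> x; rewrite inE.
apply: eq_bigr => a aJ; rewrite /fiber -sum1_card; apply: eq_bigl => x.
by rewrite !inE; case: eqP => [->|]; rewrite ?aJ ?andbF.
Qed.

Lemma dcol_lt (la : seq nat) (x : diagram la) : (dcol x < nth 0 la (drow x))%N.
Proof. by case: x => [i [c s]] /=; exact: (ltn_ord c). Qed.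

(** A half-column without repeated colours has at most [j] boxes with colours in [J], and no more
    than its height; summing over half-columns counts the first [j] rows twice. *)
Lemma column_injective_bound (la : seq nat) (I : finType) (f : diagram la -> I) (J : {set I}) (j : nat) :
  sorted geq la -> (#|J| <= j)%N ->
  (forall x y, dcol x = dcol y -> dside x = dside y -> f x = f y -> x = y) ->
  (#|[set x | f x \in J]| <= (\sum_(i < j) nth 0 la i).*2)%N.
Proof.
move=> sla Jj finj.
have lM (x : diagram la) : (dcol x < sumn la)%N by apply: leq_trans (dcol_lt x) (nth_le_sumn _ _).
pose key (x : diagram la) := (Ordinal (lM x), dside x).
rewrite -sum1_card (partition_big key xpredT) //=.
rewrite -(pair_bigA _ (fun (c : 'I_(sumn la)) s =>
  \sum_(x | (x \in [set x | f x \in J]) && (key x == (c, s))) 1)%N) /=.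
rewrite (@sum_partial_cols la j (sumn la)); last first.
  by apply/allP=> x /(nthP 0)[i _ <-]; exact: nth_le_sumn.
rewrite -muln2 big_distrl /=; apply: leq_sum => c _.
rewrite -(card_bool) mulnC -sum_nat_const; apply: leq_sum => s _.
pose X := [set x | (f x \in J) && (key x == (c, s))].
rewrite (_ : \sum_(x | _) 1 = #|X|)%N; last first.
  by rewrite -sum1_card; apply: eq_bigl => x; rewrite !inE.
have XE x : x \in X -> [/\ f x \in J, dcol x = c & dside x = s].
  by rewrite !inE => /andP[-> /eqP[E ->]]; rewrite -E.
apply: column_bound => //.
  apply: leq_trans Jj; rewrite -(card_in_imset (f := f) (D := X)).
    by apply/subset_leq_card/subsetP=> _ /imsetP[x /XE[fJ _ _] ->].
  by move=> x y /XE[_ cx sx] /XE[_ cy sy]; apply: finj; rewrite ?cx ?sx.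
rewrite -(card_in_imset (f := @drow la) (D := X)).
  rewrite -sum1_card big_mkcond /=; apply: leq_sum => i _.
  by case: imsetP => [[x /XE[_ cx _] ->]|] //; rewrite -cx dcol_lt.
by move=> x y /XE[_ cx sx] /XE[_ cy sy] E; apply: diagram_ext; rewrite ?cx ?sx.
Qed.

(** Once the colouring is fixed, the conditions on [A] and [B] separate, and the signed sum over [B]
    can be made innermost, where it cancels. *)
Lemma mcoeff_zonal (la : seq nat) (e : 'X_{1..(sumn la)}) :
  (pexp (sumn la) (zonal la))@_e =
  \sum_(f : {ffun diagram la -> 'I_(sumn la)} | coloring e f)
  \sum_(A : {ffun diagram la -> diagram la} | rowpairing A && [forall x, f (A x) == f x])
  \sum_(B : {ffun diagram la -> diagram la} | colpairing B && [forall x, f (B x) == f x])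
    colsign B.
Proof.
rewrite /pexp raddf_sum /=; under eq_bigr => r _ do rewrite mcoeffZ.
rewrite sum_zonal.
transitivity (\sum_(B : {ffun diagram la -> diagram la} | colpairing B)
  \sum_(A : {ffun diagram la -> diagram la} | rowpairing A)
  \sum_(f : {ffun diagram la -> 'I_(sumn la)} | coloring e f && (loopconst B A f)) colsign B).
  apply: eq_bigr => B /andP[pB _]; apply: eq_bigr => A /andP[pA _].
  rewrite mcoeff_pprod // sumr_const -[RHS]mulr_natr; congr (_ * _%:R).
  by apply: eq_card => f; rewrite !inE unfold_in andbC.
transitivity (\sum_(B : {ffun diagram la -> diagram la} | colpairing B)
  \sum_(f : {ffun diagram la -> 'I_(sumn la)} | coloring e f)
  \sum_(A : {ffun diagram la -> diagram la} | rowpairing A && (coloring e f && loopconst B A f))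
    colsign B).
  apply: eq_bigr => B _.
  by rewrite (exchange_big_dep
    (fun f : {ffun diagram la -> 'I_(sumn la)} => coloring e f)) //= => A f _ /andP[].
rewrite exchange_big /=; apply: eq_bigr => f cf.
have LE (B A : {ffun diagram la -> diagram la}) :
    loopconst B A f = [forall x, f (B x) == f x] && [forall x, f (A x) == f x].
  apply/loopconstP/andP=> [[H1 H2]|[/forallP H1 /forallP H2]]; last by split=> x; apply/eqP.
  by split; apply/forallP=> x; apply/eqP.
rewrite [LHS](exchange_big_dep (fun A : {ffun diagram la -> diagram la} =>
  rowpairing A && [forall x, f (A x) == f x])).
  apply: eq_bigr => A /andP[rA fA]; apply: eq_bigl => B; rewrite LE rA cf fA /= andbT.
  by [].
by move=> B A _ /and3P[-> _]; rewrite LE => /andP[].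
Qed.

Lemma zonal_dominated (la : seq nat) (e : 'X_{1..(sumn la)}) : sorted geq la ->
  (pexp (sumn la) (zonal la))@_e != 0 -> dominated (mshape e) la.
Proof.
move=> sla; apply: contraNT => nd; rewrite mcoeff_zonal big1 // => f cf; rewrite big1 // => A _.
have [/existsP[x /existsP[y /and4P[/eqP cxy /eqP sxy /eqP fxy xy]]]|inj] := boolP
  [exists x, [exists y, [&& dcol x == dcol y, dside x == dside y, f x == f y & x != y]]].
  by rewrite (colsum_cancel cxy sxy fxy xy).
case/negP: nd; apply/forallP=> j.
have [J Jj EJ] := top_sum_attained e j.
under eq_bigr => i _ do rewrite nth_mshape.
rewrite EJ -leq_double -muln2 big_distrl /=.
rewrite (eq_bigr (fiber f)); last first.
  by move=> a _; move/forallP: cf => /(_ a) /eqP; rewrite /fiber muln2 => ->.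
rewrite sum_fiber_in; apply: column_injective_bound => // x y cxy sxy fxy.
apply: contraNeq inj => xy; apply/existsP; exists x; apply/existsP; exists y.
by rewrite cxy sxy fxy xy !eqxx.
Qed.

(** For fixed [B] the sum over [A] is the [fiberweight] of the colouring by rows, with [B] as the
    fixed pairing. *)
Lemma zonal_orthogonal (la : seq nat) (d : seq nat -> rat) :
  is_partition (sumn la) la -> strictly_below (sumn la) la d -> zdot (sumn la) (zonal la) d = 0.
Proof.
move=> pla db; have /and3P[sla la0 _] := pla.
have le : (size la <= sumn la)%N by apply: size_le_sumn.
rewrite /zdot; under eq_bigr => r _ do rewrite -!mulrA [d r * _]mulrA.
rewrite (sum_zonal la (typeweight d)); apply: big1 => B /andP[pB _].
rewrite -mulr_sumr; apply/eqP; rewrite mulf_eq0; apply/orP; right; apply/eqP.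
apply: etrans (fiberweight_vanish (card_diagram la) sla la0 db pB (heavy_drow le)).
rewrite /fiberweight; apply: eq_bigl => A; congr (_ && _); exact: eq_forallb.
Qed.

(** * Normalization and uniqueness *)

Lemma mcoeff_psum_ones n : (pprod n (nseq n 1%N))@_[multinom (1%N) | i < n] = (n`!)%:R.
Proof.
have -> : pprod n (nseq n 1%N) = \sum_(f : {ffun 'I_n -> 'I_n}) 'X_[(\sum_i U_(f i))%MM].
  rewrite /pprod big_nseq -big_const_ord /psum bigA_distr_bigA; apply: eq_bigr => f _.
  by rewrite (big_morph _ (@mpolyXD _ _) (@mpolyX0 _ _)); apply: eq_bigr => i _; rewrite expr1.
rewrite raddf_sum /=; under eq_bigr => f _ do rewrite mcoeffX.
rewrite -natr_sum -big_mkcond; congr (_%:R).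
have := card_inj_ffuns 'I_n 'I_n; rewrite card_ord ffactnn => <-.
rewrite -sum1_card; apply: eq_bigl => f; rewrite inE.
have key j : (\sum_i U_(f i))%MM j = #|[set i | f i == j]|.
  rewrite mnm_sumE -sum1_card [in RHS]big_mkcond; apply: eq_bigr => i _.
  by rewrite mnmE inE; case: eqP.
apply/eqP/injectiveP=> [E i k fik | fi].
  have : (#|[set l | f l == f i]| <= 1)%N.
    by rewrite -key (congr1 (fun m : 'X_{1..n} => m (f i)) E) mnmE.
  by move/card_le1_eqP; apply; rewrite inE ?fik.
apply/mnmP=> j; rewrite key mnmE.
have [g gK Kg] := injF_bij fi.
rewrite (_ : [set i | f i == j] = [set g j]) ?cards1 //.
by apply/setP=> i; rewrite !inE; apply/eqP/eqP=> [<-|->]; rewrite ?gK ?Kg.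
Qed.

(** A pair of pairings of type [r] turns the coefficient into a count of colourings; with two labels
    of each colour, a loop of one colour has only two labels, so the type would be all ones. *)
Lemma pprod_not_ones n r : is_partition n r -> r != nseq n 1%N ->
  (pprod n r)@_[multinom (1%N) | i < n] = 0.
Proof.
move=> pr rn; pose T := diagram (nseq n 1%N).
have cT : #|T| = n.*2 by rewrite card_diagram sumn_nseq mul1n.
have pS := pairing_domino (nseq n 1%N).
have [B [pB tB]] := pairing_type_exists pS cT pr.
rewrite -tB mcoeff_pprod //; rewrite (_ : #|_| = 0%N) //; apply: eq_card0 => f; rewrite !inE.
apply: contraNF rn => /andP[/loopconstP[fS fB] /forallP cf].
have h1 x : halfsize (@domino _) B x = 1%N.
  apply/eqP; rewrite eqn_leq halfsize_gt0 // andbT -leq_double -card_loopofE //.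
  have := cf (f x); rewrite mnmE => /eqP <-; apply/subset_leq_card/subsetP=> y yx.
  by rewrite inE (loopof_const fS fB yx).
rewrite -tB; apply/eqP; apply: sorted_perm_eq; first exact: looptype_sorted.
  by elim: (n) => // [[|k]] //.
apply/perm_looptypeP => //; first by apply/allP=> x /nseqP[->].
move=> i; rewrite count_nseq /= eq_sym; case: (eqVneq i 1%N) => [->|i1].
  by rewrite mul1n mul2n -cT; apply: eq_card => x; rewrite !inE h1.
by rewrite mul0n muln0; apply: eq_card0 => x; rewrite !inE h1 eq_sym (negbTE i1).
Qed.

Lemma pexp_symmetric n c : pexp n c \is symmetric.
Proof.
apply: rpred_sum => r _; apply: rpredZ; apply: rpred_prod => i _.
apply/issymP=> s; rewrite /psum rmorph_sum (reindex_inj (@perm_inj _ s^-1%g)) /=.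
apply: eq_bigr => j _; rewrite rmorphXn /=; congr (_ ^+ _).
rewrite msymX; congr 'X_[_]; apply/mnmP=> k; rewrite mnmE !mnmE /=.
by rewrite (inj_eq perm_inj).
Qed.

(** By symmetry a leading coefficient can be read at a single exponent of the given shape. *)
Lemma mcoeff_pexp_mshape n c (e e' : 'X_{1..n}) : mshape e = mshape e' ->
  (pexp n c)@_e = (pexp n c)@_e'.
Proof.
move=> ee'.
have : perm_eq [tuple e i | i < n] [tuple e' i | i < n].
  have P (u : 'X_{1..n}) : perm_eq [tuple u i | i < n] (mshape u ++ nseq (n - size (mshape u)) 0%N).
    rewrite /= -(perm_sort geq) /mshape.
    set s := sort _ _; have sz : size s = n by rewrite size_sort size_map -cardE card_ord.
    rewrite -{1}(perm_filterC (fun x => 0 < x)%N s) perm_sym.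
    rewrite (_ : nseq _ _ = [seq x <- s | ~~ (0 < x)%N]) //.
    have -> : (n - size [seq x <- s | (0 < x)%N])%N = size [seq x <- s | ~~ (0 < x)%N].
      by rewrite -sz !size_filter -(count_predC (fun x => 0 < x)%N s) addKn.
    by apply/esym/all_pred1P/allP=> x; rewrite mem_filter -leqNgt leqn0 => /andP[].
  by rewrite (permPl (P e)) ee' perm_sym; apply: P.
case/tuple_permP=> s E.
rewrite -(msym_coeff e' s (pexp_symmetric n c)); congr (_ @_ _).
apply/mnmP=> i; rewrite mnmE.
have := congr1 (fun t => nth 0%N t i) E.
by rewrite -!tnth_nth !tnth_mktuple.
Qed.

Lemma pexp_linear n (a b : rat) (c d : seq nat -> rat) :
  pexp n (fun r => a * c r + b * d r) = a *: pexp n c + b *: pexp n d.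
Proof.
rewrite /pexp !scaler_sumr -big_split; apply: eq_bigr => r _ /=.
by rewrite scalerDl !scalerA.
Qed.

Lemma zdot_linear n (a b : rat) (c c' d : seq nat -> rat) :
  zdot n (fun r => a * c r + b * c' r) d = a * zdot n c d + b * zdot n c' d.
Proof.
rewrite /zdot !mulr_sumr -big_split; apply: eq_bigr => r _ /=.
by rewrite -!mulrA !mulrDl !mulrA.
Qed.

Lemma zdot_definite n (c : seq nat -> rat) : zdot n c c = 0 -> {in partitions n, forall r, c r = 0}.
Proof.
rewrite /zdot big_seq => /eqP; rewrite psumr_eq0 => [/allP H r rp|r rp].
  have := H r rp; rewrite rp /= !mulf_eq0 expf_eq0 andbF orbF orbb.
  case/orP=> [/eqP//|]; rewrite pnatr_eq0 -leqn0 leqNgt => /negP[].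
  move: rp; rewrite mem_partitions => /and3P[_ /allP r0 _].
  rewrite /zee big_seq; apply: prodn_cond_gt0 => i; rewrite mem_undup => /r0 i0.
  by rewrite muln_gt0 expn_gt0 i0 fact_gt0.
apply: mulr_ge0; last exact: exprn_ge0.
by apply: mulr_ge0 => //; rewrite -expr2 sqr_ge0.
Qed.

Lemma pexp_eq0 n (c : seq nat -> rat) : {in partitions n, forall r, c r = 0} -> pexp n c = 0.
Proof. by move=> c0; rewrite /pexp big_seq big1 // => r /c0 ->; rewrite scale0r. Qed.

(* A combination of two candidates without leading term is orthogonal to both of them,
   hence to itself. *)
Lemma zonal_pexp_unique (la : seq nat) (c c' : seq nat -> rat) :
  is_partition (sumn la) la -> is_zonal_pexp la c -> is_zonal_pexp la c' ->
  {in partitions (sumn la), c =1 c'}.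
Proof.
move=> pla [c1 c2 c3] [d1 d2 d3].
set n := sumn la in pla c1 c2 c3 d1 d2 d3 *.
pose e0 := [multinom nth 0%N la i | i < n].
have me0 : mshape e0 = la.
  rewrite -[RHS](filter_nth_enum pla); have /and3P[sla _ _] := pla.
  apply: sorted_perm_eq; first exact: mshape_sorted.
    by rewrite filter_nth_enum.
  rewrite (eq_filter (a2 := fun x => 0 < x)%N); last by move=> x; rewrite lt0n.
  apply: perm_filter; rewrite perm_sort (eq_map (g := fun i : 'I_n => nth 0%N la i)) //.
  by move=> i; rewrite mnmE.
have sym x (e : 'X_{1..n}) : mshape e = la -> (pexp n x)@_e = (pexp n x)@_e0.
  by move=> me; apply: mcoeff_pexp_mshape; rewrite me me0.
set a := (pexp n c)@_e0; set a' := (pexp n c')@_e0.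
pose w r := a' * c r + - a * c' r.
have wE : pexp n w = a' *: pexp n c + - a *: pexp n c' by exact: pexp_linear.
have wb : strictly_below n la w.
  move=> e; rewrite wE mcoeffD !mcoeffZ => ne; apply/andP; split.
    case: (eqVneq (pexp n c)@_e 0) ne => [->|/c1 //]; rewrite mulr0 add0r mulf_eq0 negb_or.
    by case/andP=> _ /d1.
  apply: contraNneq ne => me; rewrite !(sym _ e me) -/a -/a'; apply/eqP; ring.
have ww : zdot n w w = 0.
  by rewrite (zdot_linear n a' (- a) c c' w) (c2 w wb) (d2 w wb) !mulr0 addr0.
have w0 := zdot_definite ww.
have aa' : a' = a.
  have := pexp_eq0 w0; rewrite wE => /(congr1 (mcoeff [multinom (1%N) | i < n])).
  rewrite mcoeffD !mcoeffZ c3 d3 mcoeff0 -mulrDl => /eqP; rewrite mulf_eq0 pnatr_eq0.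
  by rewrite (negbTE (lt0n_neq0 (fact_gt0 n))) orbF subr_eq0 => /eqP.
case: (eqVneq a 0) => [a0|a0].
  have cb : strictly_below n la c.
    move=> e ne; rewrite c1 //=; apply: contraNneq ne => me.
    by rewrite (sym _ e me) -/a a0.
  have := pexp_eq0 (zdot_definite (c2 c cb)) => /(congr1 (mcoeff [multinom (1%N) | i < n])).
  rewrite c3 mcoeff0 => /eqP; rewrite pnatr_eq0.
  by rewrite (negbTE (lt0n_neq0 (fact_gt0 n))).
move=> r /w0 /eqP; rewrite /w aa' mulNr -mulrBr mulf_eq0 (negbTE a0) /= subr_eq0.
by move/eqP.
Qed.

Lemma looptype_onesP (T : finType) (A B : T -> T) n : pairing A -> pairing B -> #|T| = n.*2 ->
  (looptype A B = nseq n 1%N) <-> A =1 B.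
Proof.
move=> pA pB cT; split=> [E x | AB].
  have := card_halfsize pA pB 1%N; rewrite E count_nseq /= mul1n mul2n -cT -cardsT => H.
  have : [set x | halfsize A B x == 1%N] == [set: T] by rewrite eqEcard subsetT H leqnn.
  by move/eqP/setP/(_ x); rewrite !inE halfsize1 // => /eqP.
have h1 x : halfsize A B x = 1%N by apply/eqP; rewrite halfsize1 // AB.
apply: sorted_perm_eq; first exact: looptype_sorted.
  by case: (n) => //= m; elim: m.
apply/perm_looptypeP => //; first by apply/allP=> x /nseqP[->].
move=> i; rewrite count_nseq /= eq_sym; case: (eqVneq i 1%N) => [->|i1].
  by rewrite mul1n mul2n -cT; apply: eq_card => x; rewrite !inE h1.
by rewrite mul0n muln0; apply: eq_card0 => x; rewrite !inE h1 eq_sym (negbTE i1).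
Qed.

(** This type forces [A = B]; a pairing that keeps rows and columns and switches sides is [domino],
    whose sign is 1. *)
Lemma zonal_ones (la : seq nat) : zonal la (nseq (sumn la) 1%N) = 1.
Proof.
pose S : {ffun diagram la -> diagram la} := [ffun x => domino x].
have SE : S =1 @domino la by move=> x; rewrite ffunE.
have pS : pairing S by rewrite (eq_pairing SE) pairing_domino.
have ones := looptype_onesP _ _ (card_diagram la).
rewrite /zonal (bigD1 S) /=; last first.
  rewrite /colpairing pS; apply/forallP=> x.
  by rewrite SE dcol_domino dside_domino !eqxx.
have in1 : \sum_(A : {ffun diagram la -> diagram la} |
    rowpairing A && (looptype S A == nseq (sumn la) 1%N)) colsign S = colsign S.
  apply: big_pred1 => A; apply/idP/eqP=> [/andP[/andP[pA _] /eqP/ones]|->].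
    by move=> /(_ pS pA) E; apply/ffunP=> x; apply/esym/E.
  rewrite /rowpairing pS; apply/andP; split; last by apply/eqP/ones.
  by apply/forallP=> x; rewrite SE drow_domino.
have sS : colsign S = 1.
  rewrite /colsign -(eq_loopset SE (frefl S)) -size_looptype //.
  have /ones -> // : S =1 S by [].
  by rewrite size_nseq addnn -mul2n exprM sqrrN !expr1n.
rewrite -[RHS]addr0 -sS -[in RHS]in1; congr (_ + _).
apply: big1 => B /andP[/andP[pB /forallP cB] BS].
apply: big1 => A /andP[/andP[pA /forallP rA] /eqP/ones E].
case/eqP: BS; apply/ffunP=> x; rewrite SE.
apply: diagram_ext; rewrite ?drow_domino ?dcol_domino ?dside_domino.
- by rewrite E //; apply/eqP.
- by case/andP: (cB x) => /eqP.
- by case/andP: (cB x) => _ /eqP.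
Qed.

Lemma zonal_is_zonal (la : seq nat) : is_partition (sumn la) la -> is_zonal_pexp la (zonal la).
Proof.
move=> pla; have /and3P[sla _ _] := pla; split.
- by move=> e; apply: zonal_dominated.
- by move=> d db; apply: zonal_orthogonal.
set n := sumn la; have pone : nseq n 1%N \in partitions n.
  rewrite mem_partitions -(_ : looptype (@domino la) (@domino la) = nseq n 1%N).
    by rewrite looptype_partition ?pairing_domino // card_diagram.
  by apply/looptype_onesP; rewrite ?pairing_domino ?card_diagram.
rewrite /pexp raddf_sum /= (bigD1_seq _ pone (partitions_uniq n)) /=.
rewrite mcoeffZ mcoeff_psum_ones zonal_ones mul1r big_seq_cond big1 ?addr0 // => r.
by rewrite mem_partitions => /andP[pr rn]; rewrite mcoeffZ pprod_not_ones ?mulr0.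
Qed.

(** * Counting placements of labels *)

Section Drawings.

Variables (U : finType) (S1 S2 : U -> U) (la : seq nat).
Hypotheses (pS1 : pairing S1) (pS2 : pairing S2).

Notation D := (diagram la).

(* [g] places the labels in the diagram so that the dominoes induce [S0], while [S1] moves
   labels inside columns and [S2] inside rows. *)
Definition drawing (S0 : U -> U) (g : U -> D) : bool :=
  [forall x, [&& g (S0 x) == domino (g x), drow (g (S2 x)) == drow (g x),
                 dcol (g (S1 x)) == dcol (g x) & dside (g (S1 x)) == ~~ dside (g x)]].

Lemma drawingP (S0 : U -> U) (g : U -> D) :
  reflect [/\ forall x, g (S0 x) = domino (g x), forall x, drow (g (S2 x)) = drow (g x),
              forall x, dcol (g (S1 x)) = dcol (g x) & forall x, dside (g (S1 x)) = ~~ dside (g x)]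
          (drawing S0 g).
Proof.
apply: (iffP forallP) => [H | [H1 H2 H3 H4] x]; last by rewrite H1 H2 H3 H4 !eqxx.
by split=> x; case/and4P: (H x) => /eqP ? /eqP ? /eqP ? /eqP ?.
Qed.

(** Two labels in the same box can be exchanged in [S0] without affecting the drawing. They lie on
    the same side, and [S0] and [S1] both switch sides, so the parity of the number of loops
    changes. *)
Lemma sum_drawing_noninjective (g : {ffun U -> D}) : ~~ injectiveb g ->
  \sum_(S0 : {ffun U -> U} | pairing S0 && drawing S0 g) (-1) ^+ #|loopset S0 S1| = 0 :> rat.
Proof.
case/injectivePn=> a [b ab gab].
pose c (S0 : {ffun U -> U}) : {ffun U -> U} := [ffun z => swapconj a b S0 z].
have cE S0 : c S0 =1 swapconj a b S0 by move=> z; rewrite ffunE.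
have cK : involutive c.
  by move=> S0; apply/ffunP=> z; rewrite ffunE /swapconj cE /swapconj !tpermK.
have gt z : g (tperm a b z) = g z by case: tpermP => [->|->|].
have cc (S0 : {ffun U -> U}) : pairing S0 && drawing S0 g -> pairing (c S0) && drawing (c S0) g.
  case/andP=> pS0 /drawingP[H1 H2 H3 H4]; rewrite (eq_pairing (cE S0)) pairing_swapconj //=.
  by apply/drawingP; split=> // x; rewrite cE /swapconj gt H1 gt.
set s := \sum_(S0 | _) _.
have sN : s = - s.
  rewrite {1}/s (reindex_inj (can_inj cK)) /= -sumrN; apply: eq_big => [S0|S0 H].
    by apply/idP/idP=> H; [have := cc _ H; rewrite cK | exact: cc].
  have /andP[pS0 /drawingP[H1 H2 H3 H4]] : pairing S0 && drawing S0 g by rewrite -(cK S0); apply: cc.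
  rewrite (eq_loopset (cE S0) (frefl S1)).
  have chi0 x : dside (g (S0 x)) = ~~ dside (g x) by rewrite H1 dside_domino.
  have od := odd_loopset_swapconj pS0 pS1 chi0 H4 (congr1 (@dside la) gab) ab.
  by have := sign_flip 0 od; rewrite !add0n.
have : s *+ 2 = 0 by rewrite mulr2n {2}sN subrr.
by move/eqP; rewrite mulrn_eq0 => /eqP.
Qed.

(** Off the image of [g] the boxes keep their dominoes; there the extensions of [S1] and [S2] agree,
    which creates the additional parts equal to 1. *)
Definition extend_pairing (g : U -> D) (R : U -> U) : {ffun D -> D} :=
  [ffun y => oapp (fun x => g (R x)) (domino y) [pick x | g x == y]].

Section Injective.

Variable g : {ffun U -> D}.
Hypothesis ig : injective g.

Lemma extend_pairing_codom (R : U -> U) x : extend_pairing g R (g x) = g (R x).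
Proof.
by rewrite ffunE; case: pickP => [z /eqP/ig-> //|/(_ x)]; rewrite eqxx.
Qed.

Lemma extend_pairing_off (R : U -> U) y : y \notin codom g -> extend_pairing g R y = domino y.
Proof.
by move=> yg; rewrite ffunE; case: pickP => // z /eqP E; case/negP: yg; rewrite -E codom_f.
Qed.

Lemma pairing_extend (S0 R : U -> U) : (forall x, g (S0 x) = domino (g x)) ->
  pairing R -> pairing (extend_pairing g R).
Proof.
move=> gS0 /pairingP[RK Rn]; have /pairingP[dK dn] := pairing_domino la.
have dg y : (domino y \in codom g) = (y \in codom g).
  apply/codomP/codomP=> -[x E]; exists (S0 x); rewrite gS0 -E.
    by rewrite dK.
  by [].
apply/pairingP; split=> y; case: (boolP (y \in codom g)) => [/codomP[x ->]|yg].
- by rewrite !extend_pairing_codom RK.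
- by rewrite !extend_pairing_off ?dg // dK.
- by rewrite extend_pairing_codom (inj_eq ig) Rn.
by rewrite extend_pairing_off // dn.
Qed.

Variables (k : nat) (mu : seq nat).
Hypotheses (cU : #|U| = k.*2) (kn : (k <= sumn la)%N) (tS : looptype S1 S2 = mu).

Let cD : #|D| = (#|U| + (sumn la - k).*2)%N.
Proof. by rewrite card_diagram cU -doubleD subnKC. Qed.

Definition filling (B A : D -> D) : bool :=
  [&& colpairing B, rowpairing A, perm_eq (looptype B A) (mu ++ nseq (sumn la - k) 1%N)
    & equivariant S1 S2 B A g].

(** Off the image only parts equal to 1 remain, so [A] and [B] agree there; keeping row and column
    and switching sides leaves only [domino]. *)
Lemma filling_off (B A : D -> D) y : filling B A -> y \notin codom g ->
  B y = domino y /\ A y = domino y.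
Proof.
case/and4P=> /andP[pB /forallP cB] /andP[pA /forallP rA] ty eg yg.
have AB : B y = A y.
  by have [H _] := looptype_decomp pS1 pS2 pB pA eg ig cD; apply: H; rewrite ?tS.
suff E : B y = domino y by rewrite -AB.
case/andP: (cB y) => /eqP c1 /eqP s1.
by apply: diagram_ext; rewrite ?drow_domino ?dcol_domino ?dside_domino // AB; apply/eqP.
Qed.

(** The image of [g] is stable under [domino], because [B] coincides with [domino] off it and
    preserves it; so [domino] can be pulled back along [g] to [S0]. *)
Lemma filling_drawing (B A : D -> D) : filling B A ->
  exists2 S0 : {ffun U -> U}, pairing S0 & drawing S0 g.
Proof.
move=> fBA; have /and4P[/andP[pB /forallP cB] /andP[pA /forallP rA] ty /equivariantP[gB gA]] := fBA.
have /pairingP[BK _] := pB; have /pairingP[dK dn] := pairing_domino la.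
have dg x : domino (g x) \in codom g.
  apply/negPn/negP=> nd; have [E _] := filling_off fBA nd.
  by case/negP: nd; rewrite dK in E; rewrite -(BK (domino _)) E -gB codom_f.
pose S0 := [ffun x => odflt x [pick z | g z == domino (g x)]].
have gS0 x : g (S0 x) = domino (g x).
  by rewrite ffunE; case: pickP => [z /eqP //|]; have /codomP[z ->] := dg x; move/(_ z); rewrite eqxx.
exists S0.
  apply/pairingP; split=> x; first by apply: ig; rewrite !gS0 dK.
  by rewrite -(inj_eq ig) gS0 dn.
apply/drawingP; split=> // x; first by rewrite gA; apply/eqP.
  by rewrite gB; case/andP: (cB (g x)) => /eqP.
by rewrite gB; case/andP: (cB (g x)) => _ /eqP.
Qed.

Lemma drawing_filling (S0 : U -> U) : drawing S0 g ->
  filling (extend_pairing g S1) (extend_pairing g S2).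
Proof.
case/drawingP=> gS0 rS2 cS1 sS1.
set B := extend_pairing g S1; set A := extend_pairing g S2.
have pB : pairing B by apply: pairing_extend gS0 pS1.
have pA : pairing A by apply: pairing_extend gS0 pS2.
have eg : equivariant S1 S2 B A g.
  by apply/equivariantP; split=> x; rewrite extend_pairing_codom.
apply/and4P; split=> //.
- rewrite /colpairing pB; apply/forallP=> y; case: (boolP (y \in codom g)) => [/codomP[x ->]|yg].
    by rewrite extend_pairing_codom cS1 sS1 !eqxx.
  by rewrite extend_pairing_off // dcol_domino dside_domino !eqxx.
- rewrite /rowpairing pA; apply/forallP=> y; case: (boolP (y \in codom g)) => [/codomP[x ->]|yg].
    by rewrite extend_pairing_codom rS2 eqxx.
  by rewrite extend_pairing_off // drow_domino eqxx.
rewrite -tS; apply/(looptype_decomp pS1 pS2 pB pA eg ig cD) => y yg.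
by rewrite !extend_pairing_off.
Qed.

(** The loops of [domino] and the extension of [S1] are those of (S0, S1) and [sumn la - k] further
    ones. With the shift by [sumn la] in [colsign], this leaves the parity of k, the source of the
    sign in the formula. *)
Lemma drawing_colsign (S0 : U -> U) : pairing S0 -> drawing S0 g ->
  colsign (extend_pairing g S1) = (-1) ^+ k * (-1) ^+ #|loopset S0 S1|.
Proof.
move=> pS0 /drawingP[gS0 _ _ _]; set B := extend_pairing g S1.
have pB : pairing B by apply: pairing_extend gS0 pS1.
have eg : equivariant S0 S1 (@domino la) B g.
  by apply/equivariantP; split=> x; rewrite ?extend_pairing_codom.
have := looptype_decomp pS0 pS1 (pairing_domino la) pB eg ig cD.
case=> _ /(_ _)/perm_size; rewrite size_cat size_nseq !size_looptype ?pairing_domino // => H.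
rewrite /colsign H; last by move=> y yg; rewrite extend_pairing_off.
rewrite -exprD -signr_odd -[in RHS]signr_odd; congr (_ ^+ nat_of_bool _).
rewrite !oddD oddB //.
by case: (odd k); case: (odd (sumn la)); case: (odd _).
Qed.

(** For an injective [g] each side has at most one term, since [g] determines both [S0] and the pair
    of extended pairings; the two terms exist together. *)
Lemma sum_drawing_injective :
  \sum_(S0 : {ffun U -> U} | pairing S0 && drawing S0 g)
     (-1) ^+ k * (-1) ^+ #|loopset S0 S1| =
  \sum_(p : {ffun D -> D} * {ffun D -> D} | filling p.1 p.2) colsign p.1.
Proof.
have [S0 /andP[pS0 dS0] | none] := pickP (fun S0 : {ffun U -> U} => pairing S0 && drawing S0 g).
  have /drawingP[gS0 _ _ _] := dS0.
  rewrite (big_pred1 S0) => [|R]; last first.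
    apply/andP/eqP=> [[pR /drawingP[gR _ _ _]]|-> //].
    by apply/ffunP=> x; apply: ig; rewrite gR gS0.
  rewrite (big_pred1 (extend_pairing g S1, extend_pairing g S2)) /=.
    by rewrite (drawing_colsign pS0 dS0).
  move=> [B A]; apply/idP/eqP=> [fBA|[-> ->]]; last exact: drawing_filling dS0.
  have /and4P[_ _ _ /equivariantP[gB gA]] := fBA.
  congr (_, _); apply/ffunP=> y; case: (boolP (y \in codom g)) => [/codomP[x ->]|yg].
  - by rewrite extend_pairing_codom -gB.
  - by rewrite extend_pairing_off //; case: (filling_off fBA yg).
  - by rewrite extend_pairing_codom -gA.
  - by rewrite extend_pairing_off //; case: (filling_off fBA yg).
rewrite !big_pred0 // => -[B A].
apply/negP=> /filling_drawing[S0 pS0 dS0].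
by have := none S0; rewrite pS0 dS0.
Qed.

End Injective.

End Drawings.

Lemma sorted_extended (mu : seq nat) j : sorted geq mu -> all (fun x => 0 < x)%N mu ->
  sorted geq (mu ++ nseq j 1%N).
Proof.
have tr : transitive geq by move=> y x z xy yz; apply: leq_trans yz xy.
rewrite !(sorted_pairwise tr) pairwise_cat => -> mu0; apply/andP; split.
  by apply/allrelP=> x y /(allP mu0) x0 /nseqP[->].
by elim: j => //= j ->; rewrite andbT; apply/allP=> x /nseqP[->].
Qed.

Lemma Sigma2_drawings (U : finType) (S1 S2 : U -> U) (k : nat) (mu la : seq nat) :
  pairing S1 -> pairing S2 -> #|U| = k.*2 -> looptype S1 S2 = mu ->
  2 ^+ size mu * Sigma2 mu la (zonal la) =
  (-1) ^+ k * \sum_(S0 : {ffun U -> U} | pairing S0)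
    (-1) ^+ #|loopset S0 S1| * #|[set g : {ffun U -> diagram la} | drawing S1 S2 S0 g]|%:R.
Proof.
move=> pS1 pS2 cU tS; have := looptype_partition pS1 pS2 cU; rewrite tS => /and3P[smu mu0 /eqP kmu].
pose sg (S0 : {ffun U -> U}) : rat := (-1) ^+ k * (-1) ^+ #|loopset S0 S1|.
transitivity (\sum_(g : {ffun U -> diagram la} | injectiveb g)
    \sum_(S0 : {ffun U -> U} | pairing S0 && drawing S1 S2 S0 g) sg S0); last first.
  transitivity (\sum_(g : {ffun U -> diagram la})
      \sum_(S0 : {ffun U -> U} | pairing S0 && drawing S1 S2 S0 g) sg S0).
    rewrite [RHS](bigID (fun g : {ffun U -> diagram la} => injectiveb g)) /= [X in _ = _ + X]big1 ?addr0 //.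
    by move=> g ng; rewrite /sg -mulr_sumr sum_drawing_noninjective ?mulr0.
  rewrite mulr_sumr (exchange_big_dep (fun S0 : {ffun U -> U} => pairing S0)) /=;
    last by move=> g S0 _ /andP[].
  apply: eq_bigr => S0 pS0; rewrite mulrA -/(sg S0) mulr_natr -sumr_const.
  by apply: eq_bigl => g; rewrite inE pS0.
rewrite /Sigma2 kmu; case: leqP => [kn|nk]; last first.
  (* With 2k labels and fewer boxes there is no injective placement, in agreement with the value 0
     of [Sigma2]. *)
  rewrite mulr0 big_pred0 // => g; apply/negP=> /injectiveP /leq_card.
  by rewrite cU card_diagram leq_double leqNgt nk.
pose P (p : {ffun diagram la -> diagram la} * {ffun diagram la -> diagram la}) :=
  [&& colpairing p.1, rowpairing p.2 & looptype p.1 p.2 == mu ++ nseq (sumn la - k) 1%N].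
transitivity (\sum_(g : {ffun U -> diagram la} | injectiveb g)
    \sum_(p : {ffun diagram la -> diagram la} * {ffun diagram la -> diagram la} |
       P p && equivariant S1 S2 p.1 p.2 g) colsign p.1); last first.
  apply: eq_bigr => g /injectiveP ig; rewrite (sum_drawing_injective pS1 pS2 ig cU kn tS).
  apply: eq_bigl => -[B A]; rewrite /P /filling /=.
  have -> : perm_eq (looptype B A) (mu ++ nseq (sumn la - k) 1%N) =
      (looptype B A == mu ++ nseq (sumn la - k) 1%N).
    apply/idP/eqP => [|->]; last exact: perm_refl.
    by apply: sorted_perm_eq; rewrite ?looptype_sorted // sorted_extended.
  by rewrite -!andbA.
rewrite (exchange_big_dep P) /=; last by move=> g p _ /andP[].
transitivity (\sum_(p | P p) colsign p.1 *
   (2 ^ size mu * zee mu * 'C(sumn la - k + mult 1 mu, mult 1 mu))%N%:R); last first.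
  apply: eq_bigr => -[B A] PBA; have /and3P[/= /andP[pB _] /andP[pA _] /eqP tBA] := PBA.
  rewrite sumr_const mulr_natr.
  congr (_ *+ _); rewrite -tS.
  rewrite -(loopcount_extended _ (ss := map (halfsize S1 S2) (loopreps S1 S2))); last first.
    by rewrite perm_sym perm_looptype.
  rewrite tS -tBA -card_embeddings //; apply: eq_card => g; rewrite inE unfold_in PBA /=.
  by rewrite andbC.
have zE : zonal la (mu ++ nseq (sumn la - k) 1%N) = \sum_(p | P p) colsign p.1.
  by rewrite /zonal pair_big_dep.
have reorder (a b c z : rat) : a * (b * c * z) = z * (a * c * b) by ring.
by rewrite -mulr_suml -zE reorder !natrM natrX.
Qed.

(** * Counting drawings for a fixed pairing of labels *)

Lemma prod_bool (T : finType) (P : pred T) (b : T -> bool) :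
  \prod_(x | P x) (b x)%:R = [forall (x | P x), b x]%:R :> rat.
Proof.
case: (boolP [forall (x | P x), b x]) => [/forall_inP H|].
  by rewrite big1 // => x /H ->.
rewrite negb_forall => /existsP[x]; rewrite negb_imply => /andP[Px /negbTE bx].
by rewrite (bigD1 x) //= bx mul0r.
Qed.

Section CardDrawings.

Variables (U : finType) (S0 S1 S2 : U -> U) (la : seq nat).
Hypotheses (pS0 : pairing S0) (pS1 : pairing S1).

Notation D := (diagram la).
Notation M := (sumn la).

Lemma dcol_sumn (x : D) : (dcol x < M)%N.
Proof. by apply: leq_trans (dcol_lt x) (nth_le_sumn _ _). Qed.

Variable h : {ffun U -> 'I_(size la)}.
Hypothesis hc : loopconst S0 S2 h.

Definition fits (u : U -> 'I_M * bool) : bool := [forall x, ((u x).1 < nth 0 la (h x))%N].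

(** With the rows given by [h], a drawing consists of columns and sides. Sides alternate under [S0]
    and [S1], so after adding an orientation of their loops they become constant on loops, as the
    columns already are. *)
Lemma card_drawings_row :
  #|[set g : {ffun U -> D} | drawing S1 S2 S0 g && ([ffun x => drow (g x)] == h)]| =
  #|[set u : {ffun U -> 'I_M * bool} | loopconst S0 S1 u && fits u]|.
Proof.
have [chi [chi0 chi1]] := orientation_exists pS0 pS1.
pose c (g : {ffun U -> D}) : {ffun U -> 'I_M * bool} :=
  [ffun x => (Ordinal (dcol_sumn (g x)), dside (g x) (+) chi x)].
have rE (g : {ffun U -> D}) x : [ffun x => drow (g x)] == h -> drow (g x) = h x.
  by move/eqP/ffunP/(_ x); rewrite ffunE.
rewrite -(card_in_imset (f := c)); last first.
  move=> g g'; rewrite !inE => /andP[_ gh] /andP[_ gh'] /ffunP E; apply/ffunP=> x.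
  have := E x; rewrite !ffunE => -[cE /addIb sE].
  by apply: diagram_ext; rewrite ?rE.
apply: eq_card => u; rewrite inE; apply/imsetP/andP=> [[g] | [/loopconstP[u0 u1] /forallP fu]].
  rewrite inE => /andP[/drawingP[g0 g2 c1 s1] gh] ->; split.
    apply/loopconstP; split=> x; rewrite !ffunE.
      congr (_, _); first by apply: val_inj; rewrite /= g0 dcol_domino.
      by rewrite g0 dside_domino chi0; case: (dside _); case: (chi x).
    congr (_, _); first by apply: val_inj; rewrite /= c1.
    by rewrite s1 chi1; case: (dside _); case: (chi x).
  by apply/forallP=> x; rewrite ffunE /= -(rE g x gh) dcol_lt.
have [h0 h2] := loopconstP _ _ _ hc.
pose g : {ffun U -> D} := [ffun x => box (Ordinal (fu x)) ((u x).2 (+) chi x)].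
have gr x : drow (g x) = h x by rewrite ffunE.
have gc x : dcol (g x) = (u x).1 by rewrite ffunE.
have gs x : dside (g x) = (u x).2 (+) chi x by rewrite ffunE.
exists g; last first.
  apply/ffunP=> x; rewrite ffunE gs addbK; case: (u x) (gc x) => a b /= E.
  by congr (_, _); apply: val_inj.
rewrite inE; apply/andP; split; last by apply/eqP/ffunP=> x; rewrite ffunE gr.
apply/drawingP; split=> x.
- apply: diagram_ext; rewrite ?drow_domino ?dcol_domino ?dside_domino.
  + by rewrite !gr h0.
  + by rewrite !gc u0.
  by rewrite !gs u0 chi0; case: (u x).2; case: (chi x).
- by rewrite !gr h2.
- by rewrite !gc u1.
by rewrite !gs u1 chi1; case: (u x).2; case: (chi x).
Qed.

(** Each loop of (S0, S1) chooses a side, hence the factor 2, and a column present in every row that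
    the loop visits. *)
Lemma card_fits :
  #|[set u : {ffun U -> 'I_M * bool} | loopconst S0 S1 u && fits u]|%:R =
  \prod_(x | looprep S0 S1 x == x)
     (2 * #|[set v : 'I_M | [forall (y | y \in loopof S0 S1 x), (v < nth 0 la (h y))%N]]|%:R) :> rat.
Proof.
pose F x (v : 'I_M * bool) : rat := [forall (y | y \in loopof S0 S1 x), (v.1 < nth 0%N la (h y))%N]%:R.
transitivity (\prod_(x | looprep S0 S1 x == x) \sum_v F x v); last first.
  apply: eq_bigr => x _; rewrite -(pair_bigA _ (fun a b => F x (a, b))) /=.
  transitivity (\sum_a 2 * F x (a, true)).
    by apply: eq_bigr => a _; rewrite big_bool /F /= mulr_natl mulr2n.
  rewrite -mulr_sumr; congr (_ * _); rewrite -sum1_card natr_sum [RHS]big_mkcond.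
  by apply: eq_bigr => a _; rewrite inE /F /=; case: ifP.
rewrite -sum_loopconst // -sum1_card natr_sum.
transitivity (\sum_(u : {ffun U -> 'I_M * bool} | loopconst S0 S1 u) (fits u)%:R : rat).
  rewrite [RHS](bigID (fun u : {ffun U -> 'I_M * bool} => fits u)) /=.
  rewrite [X in _ = _ + X]big1 ?addr0; last by move=> u /andP[_ /negbTE->].
  by apply: eq_big => [u|u]; rewrite inE // => /andP[_ ->].
apply: eq_bigr => u uc; rewrite prod_bool; congr ((nat_of_bool _)%:R).
apply/forallP/forall_inP=> H x; last first.
  have /eqP rx : looprep S0 S1 (looprep S0 S1 x) == looprep S0 S1 x by rewrite looprep_id.
  have := H _ (introT eqP rx) => /forall_inP/(_ x).
  rewrite (loopconst_rep x pS0 pS1 uc); apply.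
  by rewrite loopof_rep // mem_loopof.
move=> rx; apply/forall_inP=> y yx.
have [u0 u1] := loopconstP _ _ _ uc.
by rewrite -(loopof_const u0 u1 yx).
Qed.

End CardDrawings.

Lemma card_drawings (U : finType) (S0 S1 S2 : U -> U) (la : seq nat) :
  pairing S0 -> pairing S1 ->
  #|[set g : {ffun U -> diagram la} | drawing S1 S2 S0 g]|%:R =
  \sum_(h : {ffun U -> 'I_(size la)} | loopconst S0 S2 h)
    \prod_(x | looprep S0 S1 x == x)
      (2 * #|[set v : 'I_(sumn la) |
               [forall (y | y \in loopof S0 S1 x), (v < nth 0 la (h y))%N]]|%:R) :> rat.
Proof.
move=> pS0 pS1; rewrite -sum1_card natr_sum.
rewrite (partition_big (fun g : {ffun U -> diagram la} => [ffun x => drow (g x)])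
   (fun h : {ffun U -> 'I_(size la)} => loopconst S0 S2 h)) /=; last first.
  move=> g; rewrite inE => /drawingP[g0 g2 _ _].
  by apply/loopconstP; split=> x; rewrite !ffunE ?g0 ?drow_domino.
apply: eq_bigr => h hc; rewrite -(card_fits pS0 pS1 h) -(card_drawings_row pS0 pS1 hc).
by rewrite -sum1_card natr_sum; apply: eq_bigl => g; rewrite !inE.
Qed.

(** * Groups of equal rows and labellings of loops *)

Definition rowgroups (p : seq nat) : seq nat :=
  flatten [seq nseq (nth 0%N p i) i.+1 | i <- iota 0 (size p)].

Lemma ptimes_rowgroups (p q : seq nat) : size p = size q ->
  ptimes p q = map (at1 q) (rowgroups p).
Proof.
move=> spq; rewrite /ptimes /rowgroups map_flatten -map_comp; congr flatten.
apply: (@eq_from_nth _ [::]); rewrite !size_map size_zip spq minnn ?size_iota // => i iq.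
rewrite (nth_map (0%N, 0%N)) ?size_zip ?spq ?minnn // nth_zip //=.
by rewrite (nth_map 0%N) ?size_iota // nth_iota //= map_nseq.
Qed.

Lemma count_rowgroups (p : seq nat) (j : nat) : (0 < j)%N ->
  count_mem j (rowgroups p) = at1 p j.
Proof.
case: j => // j _; rewrite count_flatten sumnE !big_map /=.
under eq_bigr => i _ do rewrite count_nseq /= eqSS.
case: (ltnP j (size p)) => jp.
  rewrite (bigD1_seq j) ?mem_iota ?iota_uniq //= eqxx mul1n big1 ?addn0 // => i.
  by move=> /negbTE ->.
rewrite nth_default // big_seq big1 // => i; rewrite mem_iota add0n => /andP[_ ip].
by rewrite (ltn_eqF (leq_trans ip jp)).
Qed.

Lemma mem_rowgroups (p : seq nat) (x : nat) : x \in rowgroups p -> (0 < x <= size p)%N.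
Proof.
case/flattenP=> s /mapP[i]; rewrite mem_iota add0n => /andP[_ ip] -> /nseqP[-> _].
by rewrite ip.
Qed.

Lemma at1_antitone (q : seq nat) i j : sorted geq q -> (0 < i)%N -> (i <= j)%N ->
  (at1 q j <= at1 q i)%N.
Proof. by case: i j => [|i] [|j] // sq _ ij; apply: geq_sorted_nth. Qed.

Lemma ptimes_partition (p q : seq nat) : all (fun x => 0 < x)%N q -> sorted geq q ->
  is_partition (sumn (ptimes p q)) (ptimes p q).
Proof.
have mem u v x : x \in ptimes u v -> x \in v.
  elim: u v => [|a u IH] [|b v] //; rewrite /ptimes /= mem_cat => /orP[/nseqP[-> _]|/IH xv].
    by rewrite mem_head.
  by rewrite inE xv orbT.
move=> q0 sq; rewrite /is_partition eqxx andbT; apply/andP; split; last first.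
  by apply/allP=> x /mem /(allP q0).
have tr : transitive geq by move=> y x z xy yz; apply: leq_trans yz xy.
elim: p q sq {q0} => [|a p IH] [|b q] // sq; rewrite /ptimes /=.
rewrite (sorted_pairwise tr) pairwise_cat -!(sorted_pairwise tr) IH ?(path_sorted sq) // andbT.
apply/andP; split.
  apply/allrelP=> x y /nseqP[-> _] /mem yq.
  by move: sq => /= /(order_path_min tr)/allP/(_ y yq).
by case: a => //= a; elim: a => //= a ->; rewrite leqnn.
Qed.

Section Groups.

Variables (U : finType) (S0 S1 S2 : U -> U) (p q : seq nat).
Hypotheses (pS0 : pairing S0) (pS1 : pairing S1) (pS2 : pairing S2).
Hypotheses (spq : size p = size q) (sq : sorted geq q).

Notation la := (ptimes p q).
Notation m := (size p).

Definition rowgroup (i : 'I_(size la)) : 'I_m.+1 := inord (nth 0%N (rowgroups p) i).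

Let lt_groups (i : 'I_(size la)) : (i < size (rowgroups p))%N.
Proof. by have := ltn_ord i; rewrite {2}ptimes_rowgroups // size_map. Qed.

Lemma rowgroupE i : rowgroup i = nth 0%N (rowgroups p) i :> nat.
Proof.
by rewrite inordK // ltnS; case/andP: (mem_rowgroups (mem_nth 0%N (lt_groups i))).
Qed.

Lemma rowgroup_neq0 i : rowgroup i != ord0.
Proof.
by rewrite -val_eqE /= rowgroupE -lt0n; case/andP: (mem_rowgroups (mem_nth 0%N (lt_groups i))).
Qed.

Lemma nth_rowgroup (i : 'I_(size la)) : nth 0%N la i = at1 q (rowgroup i).
Proof.
rewrite rowgroupE; move: (nat_of_ord i) (lt_groups i) => j jp.
by rewrite ptimes_rowgroups // (nth_map 0%N).
Qed.

Lemma card_rowgroup (j : 'I_m.+1) : j != ord0 -> #|[set i | rowgroup i == j]| = at1 p j.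
Proof.
rewrite -val_eqE -lt0n => j0; rewrite -count_rowgroups // -sum1_card -sum1_count.
rewrite big_mkcond [RHS]big_mkcond (big_nth 0%N) big_mkord /=.
have E : size la = size (rowgroups p) by rewrite ptimes_rowgroups // size_map.
rewrite -E; apply: eq_bigr => i _.
by rewrite inE -val_eqE /= rowgroupE.
Qed.

(** The labelling of loops induced by an assignment of rows. Groups are numbered from 1, so that 0
    can mark the sets that are not loops. *)
Definition groups_of (h : U -> 'I_(size la)) : {ffun {set U} -> 'I_m.+1} :=
  [ffun l => if [pick x | loopof S0 S2 x == l] is Some x then rowgroup (h x) else ord0].

Definition loop_labelling (phi : {ffun {set U} -> 'I_m.+1}) : bool :=
  [forall l, (l \in loopset S0 S2) == (phi l != ord0)].

Lemma groups_of_loopof (h : {ffun U -> 'I_(size la)}) x : loopconst S0 S2 h ->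
  groups_of h (loopof S0 S2 x) = rowgroup (h x).
Proof.
case/loopconstP=> h0 h2; rewrite ffunE; case: pickP => [z|/(_ x)]; last by rewrite eqxx.
rewrite loopof_eq // => xz.
by rewrite (loopof_const h0 h2 xz).
Qed.

Lemma groups_of_labelling (h : {ffun U -> 'I_(size la)}) : loop_labelling (groups_of h).
Proof.
apply/forallP=> l; rewrite ffunE; case: pickP => [x /eqP <-|nx].
  by rewrite rowgroup_neq0 imset_f.
by rewrite eqxx; apply/eqP/negbTE/imsetP=> -[x _ E]; have := nx x; rewrite E eqxx.
Qed.

Lemma groups_of_eq (h : {ffun U -> 'I_(size la)}) (phi : {ffun {set U} -> 'I_m.+1}) :
  loopconst S0 S2 h -> loop_labelling phi ->
  (groups_of h == phi) = [forall x, rowgroup (h x) == phi (loopof S0 S2 x)].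
Proof.
move=> hc /forallP ph; apply/eqP/forallP=> [<- x|H]; first by rewrite groups_of_loopof.
apply/ffunP=> l; case: (boolP (l \in loopset S0 S2)) => [/imsetP[x _ ->]|nl].
  by rewrite groups_of_loopof //; apply/eqP.
have /forallP/(_ l)/eqP := groups_of_labelling h; rewrite (negbTE nl) => /esym/negbFE/eqP->.
by have /eqP := ph l; rewrite (negbTE nl) => /esym/negbFE/eqP->.
Qed.

Definition maxlabel (phi : {ffun {set U} -> 'I_m.+1}) (l' : {set U}) : nat :=
  (\max_(l in loopset S0 S2 | l :&: l' != set0) (phi l : nat))%N.

(** As [q] decreases, the shortest row visited by the loop belongs to the group with the largest
    number, and a column fits every visited row as soon as it fits that one. *)
Lemma card_columns (h : {ffun U -> 'I_(size la)}) x : loopconst S0 S2 h ->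
  #|[set v : 'I_(sumn la) | [forall (y | y \in loopof S0 S1 x), (v < nth 0 la (h y))%N]]| =
  at1 q (maxlabel (groups_of h) (loopof S0 S1 x)).
Proof.
move=> hc; set l' := loopof S0 S1 x; set mx := maxlabel _ _.
have nthh y : nth 0%N la (h y) = at1 q (groups_of h (loopof S0 S2 y)).
  by rewrite groups_of_loopof // nth_rowgroup.
have meet y : y \in l' -> (loopof S0 S2 y \in loopset S0 S2) && (loopof S0 S2 y :&: l' != set0).
  by move=> yl; rewrite imset_f //=; apply/set0Pn; exists y; rewrite inE mem_loopof.
(* A label of [l'] whose loop for (S0, S2) attains the maximum. *)
have [w wl wm] : exists2 w, w \in l' & groups_of h (loopof S0 S2 w) = mx :> nat.
  pose A := [pred l | (l \in loopset S0 S2) && (l :&: l' != set0)].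
  have A0 : (0 < #|A|)%N.
    by apply/card_gt0P; exists (loopof S0 S2 x); rewrite inE; apply: meet; apply: mem_loopof.
  have [l] := eq_bigmax_cond (fun l => groups_of h l : nat) A0.
  rewrite inE => /andP[/imsetP[z _ ->] /set0Pn[w]]; rewrite inE => /andP[wz wl] E.
  exists w => //; move: wz; rewrite -loopof_eq // => /eqP <-; rewrite -E.
  by apply: eq_bigl => t; rewrite inE.
rewrite -wm -nthh -[RHS](minn_idPr (nth_le_sumn la (h w))) -sum_ltn -sum1_card big_mkcond.
apply: eq_bigr => v _; rewrite inE.
have -> : [forall (y | y \in l'), (v < nth 0 la (h y))%N] = (v < nth 0 la (h w))%N.
  apply/forall_inP/idP=> [/(_ w wl) //|vw y yl].
  apply: (leq_trans vw); rewrite !nthh wm; apply: at1_antitone => //.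
    by rewrite groups_of_loopof // lt0n; have := rowgroup_neq0 (h y); rewrite -val_eqE.
  by rewrite /mx /maxlabel; apply: (@leq_bigmax_cond _ _ (fun l => groups_of h l : nat)); apply: meet.
by case: (_ < _)%N.
Qed.

(** For a given labelling each loop of (S0, S2) chooses its row freely inside its group, whence the
    factors p. The sign supplies one -1 for each loop of (S0, S1), which turns the factors 2q into
    -2q. *)
Lemma card_drawings_labelled :
  (-1) ^+ #|loopset S0 S1| * #|[set g : {ffun U -> diagram la} | drawing S1 S2 S0 g]|%:R =
  \sum_(phi : {ffun {set U} -> 'I_m.+1} | loop_labelling phi)
    ((\prod_(l in loopset S0 S2) (at1 p (phi l))%:R) *
     \prod_(l' in loopset S0 S1) (- 2 * (at1 q (maxlabel phi l'))%:R)) :> rat.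
Proof.
rewrite card_drawings //.
rewrite (partition_big (fun h : {ffun U -> 'I_(size la)} => groups_of h) loop_labelling) /=;
  last by move=> h _; exact: groups_of_labelling.
rewrite mulr_sumr; apply: eq_bigr => phi lphi.
have -> : \prod_(l' in loopset S0 S1) (- 2 * (at1 q (maxlabel phi l'))%:R) =
   (-1) ^+ #|loopset S0 S1| * \prod_(l' in loopset S0 S1) (2 * (at1 q (maxlabel phi l'))%:R) :> rat.
  by rewrite -prodr_const -big_split; apply: eq_bigr => l _ /=; rewrite mulN1r mulNr.
rewrite mulrCA; congr (_ * _).
transitivity ((\sum_(h : {ffun U -> 'I_(size la)} | loopconst S0 S2 h && (groups_of h == phi)) 1) *
    \prod_(l' in loopset S0 S1) (2 * (at1 q (maxlabel phi l'))%:R) : rat).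
  rewrite mulr_suml; apply: eq_bigr => h /andP[hc /eqP <-].
  rewrite mul1r big_loopset //; apply: eq_bigr => x _.
  by rewrite card_columns.
congr (_ * _); rewrite big_loopset //.
transitivity (\prod_(x | looprep S0 S2 x == x)
    \sum_(i : 'I_(size la)) (rowgroup i == phi (loopof S0 S2 x))%:R : rat).
  rewrite -sum_loopconst // big_mkcondr; apply: eq_bigr => h hc.
  rewrite prod_bool groups_of_eq //.
  have -> : [forall x, rowgroup (h x) == phi (loopof S0 S2 x)] =
    [forall (x | looprep S0 S2 x == x), rowgroup (h x) == phi (loopof S0 S2 x)].
    apply/forallP/forall_inP=> H x; first by move=> _; exact: H.
    rewrite -(loopconst_rep x pS0 pS2 hc) -(loopof_rep pS0 pS2 x).
    by apply: H; rewrite looprep_id.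
  by case: ifP.
apply: eq_bigr => x _; rewrite -natr_sum; congr (_%:R).
rewrite -card_rowgroup; last by move/forallP: lphi => /(_ (loopof S0 S2 x)) /eqP <-; rewrite imset_f.
by rewrite -sum1_card [RHS]big_mkcond; apply: eq_bigr => i _; rewrite inE; case: ifP.
Qed.

End Groups.

Theorem theorem1p8 (k : nat) (mu : seq nat)
    (S1 S2 : {ffun 'I_(k.*2) -> 'I_(k.*2)}) (p q : seq nat)
    (theta : seq nat -> rat) :
  is_partition k mu ->
  pairpart S1 -> pairpart S2 -> ptype S1 S2 = mu ->
  size p = size q ->
  all (fun x => 0 < x)%N p -> all (fun x => 0 < x)%N q -> sorted geq q ->
  is_zonal_pexp (ptimes p q) theta ->
  Sigma2 mu (ptimes p q) theta =
    (-1) ^+ k / 2 ^+ size mu *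
    \sum_(S0 : {ffun 'I_(k.*2) -> 'I_(k.*2)} | pairpart S0)
      \sum_(phi : {ffun {set 'I_(k.*2)} -> 'I_(size p).+1} | loopfun S0 S2 phi)
        ((\prod_(l in loops S0 S2) (at1 p (phi l))%:R) *
         \prod_(l' in loops S0 S1)
           (- 2 * (at1 q (\max_(l in loops S0 S2 | l :&: l' != set0)
                            (phi l : nat)))%:R)).
Proof.
move=> /and3P[smu mu0 /eqP kmu] pS1 pS2 tS spq _ q0 sq ztheta.
have pla := ptimes_partition p q0 sq.
(* Coefficients are unique only on partitions of the right size; [Sigma2] reads a single one, at
   [mu] extended by ones, which is such a partition. *)
have -> : Sigma2 mu (ptimes p q) theta = Sigma2 mu (ptimes p q) (zonal (ptimes p q)).
  rewrite /Sigma2; case: leqP => // kn; congr (_ * _).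
  apply: (zonal_pexp_unique pla ztheta (zonal_is_zonal pla)).
  rewrite mem_partitions /is_partition sorted_extended //= all_cat mu0 sumn_cat sumn_nseq mul1n.
  by rewrite subnKC // eqxx andbT; apply/allP=> x /nseqP[->].
have card_labels : #|'I_(k.*2)| = k.*2 by rewrite card_ord.
have := Sigma2_drawings (ptimes p q) pS1 pS2 card_labels tS.
have two_neq0 : 2 ^+ size mu != 0 :> rat by rewrite expf_neq0.
move/(canRL (mulKf two_neq0)) => ->; rewrite mulrA [_^-1 * _]mulrC; congr (_ * _).
apply: eq_bigr => S0 pS0.
(* The notions for labels in an ordinal are convertible to those for arbitrary finite types. *)
exact: (card_drawings_labelled pS0 pS1 pS2 spq sq).
Qed.
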